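(* Let $N$ be a nonlinear connection on $E^*=J^{1*}(\mathcal T,M)$ and $D$ an $N$-linear connection. The curvature tensor $\mathbb R$ of $D$ is completely determined by $18$ local d-tensors (the d-tensors of curvature), defined in the adapted basis by $$\mathbb R\left(\tfrac{\delta}{\delta t^c},\tfrac{\delta}{\delta t^b}\right)\tfrac{\delta}{\delta t^a}=R^d_{abc}\tfrac{\delta}{\delta t^d},\ \ \mathbb R\left(\tfrac{\delta}{\delta t^c},\tfrac{\delta}{\delta t^b}\right)\tfrac{\delta}{\delta x^i}=R^l_{ibc}\tfrac{\delta}{\delta x^l},\ \ \mathbb R\left(\tfrac{\delta}{\delta t^c},\tfrac{\delta}{\delta t^b}\right)\tfrac{\partial}{\partial p^a_i}=-R^{(d)(i)}_{(l)(a)bc}\tfrac{\partial}{\partial p^d_l},$$ $$\mathbb R\left(\tfrac{\delta}{\delta x^k},\tfrac{\delta}{\delta t^b}\right)\tfrac{\delta}{\delta t^a}=R^d_{abk}\tfrac{\delta}{\delta t^d},\ \ \mathbb R\left(\tfrac{\delta}{\delta x^k},\tfrac{\delta}{\delta t^b}\right)\tfrac{\delta}{\delta x^i}=R^l_{ibk}\tfrac{\delta}{\delta x^l},\ \ \mathbb R\left(\tfrac{\delta}{\delta x^k},\tfrac{\delta}{\delta t^b}\right)\tfrac{\partial}{\partial p^a_i}=-R^{(d)(i)}_{(l)(a)bk}\tfrac{\partial}{\partial p^d_l},$$ $$\mathbb R\left(\tfrac{\partial}{\partial p^c_k},\tfrac{\delta}{\delta t^b}\right)\tfrac{\delta}{\delta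 t^a}=P^{d\ (k)}_{ab(c)}\tfrac{\delta}{\delta t^d},\ \ \mathbb R\left(\tfrac{\partial}{\partial p^c_k},\tfrac{\delta}{\delta t^b}\right)\tfrac{\delta}{\delta x^i}=P^{l\ (k)}_{ib(c)}\tfrac{\delta}{\delta x^l},\ \ \mathbb R\left(\tfrac{\partial}{\partial p^c_k},\tfrac{\delta}{\delta t^b}\right)\tfrac{\partial}{\partial p^a_i}=-P^{(d)(i)\ (k)}_{(l)(a)b(c)}\tfrac{\partial}{\partial p^d_l},$$ $$\mathbb R\left(\tfrac{\delta}{\delta x^k},\tfrac{\delta}{\delta x^j}\right)\tfrac{\delta}{\delta t^a}=R^d_{ajk}\tfrac{\delta}{\delta t^d},\ \ \mathbb R\left(\tfrac{\delta}{\delta x^k},\tfrac{\delta}{\delta x^j}\right)\tfrac{\delta}{\delta x^i}=R^l_{ijk}\tfrac{\delta}{\delta x^l},\ \ \mathbb R\left(\tfrac{\delta}{\delta x^k},\tfrac{\delta}{\delta x^j}\right)\tfrac{\partial}{\partial p^a_i}=-R^{(d)(i)}_{(l)(a)jk}\tfrac{\partial}{\partial p^d_l},$$ $$\mathbb R\left(\tfrac{\partial}{\partial p^c_k},\tfrac{\delta}{\delta x^j}\right)\tfrac{\delta}{\delta t^a}=P^{d\ (k)}_{aj(c)}\tfrac{\delta}{\delta t^d},\ \ \mathbb R\left(\tfrac{\partial}{\partial p^c_k},\tfrac{\delta}{\delta x^j}\right)\tfrac{\delta}{\delta x^i}=P^{l\ (k)}_{ij(c)}\tfrac{\delta}{\delta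 x^l},\ \ \mathbb R\left(\tfrac{\partial}{\partial p^c_k},\tfrac{\delta}{\delta x^j}\right)\tfrac{\partial}{\partial p^a_i}=-P^{(d)(i)\ (k)}_{(l)(a)j(c)}\tfrac{\partial}{\partial p^d_l},$$ $$\mathbb R\left(\tfrac{\partial}{\partial p^c_k},\tfrac{\partial}{\partial p^b_j}\right)\tfrac{\delta}{\delta t^a}=S^{d(j)(k)}_{a(b)(c)}\tfrac{\delta}{\delta t^d},\ \ \mathbb R\left(\tfrac{\partial}{\partial p^c_k},\tfrac{\partial}{\partial p^b_j}\right)\tfrac{\delta}{\delta x^i}=S^{l(j)(k)}_{i(b)(c)}\tfrac{\delta}{\delta x^l},\ \ \mathbb R\left(\tfrac{\partial}{\partial p^c_k},\tfrac{\partial}{\partial p^b_j}\right)\tfrac{\partial}{\partial p^a_i}=-S^{(d)(i)(j)(k)}_{(l)(a)(b)(c)}\tfrac{\partial}{\partial p^d_l}.$$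
   Context: All objects are smooth. $\mathcal T,M$ are manifolds of dimensions $m,n$ with local coordinates $(t^a)$, $(x^i)$. Indices $a,\dots,h$ run over $\{1,\dots,m\}$, indices $i,j,k,l,p,q,r,s$ over $\{1,\dots,n\}$; Einstein summation is used. $E^*=J^{1*}(\mathcal T,M)$ is the dual of the $1$-jet bundle: a vector bundle $\pi^*:E^*\to\mathcal T\times M$ with fibre $\mathbb R^{mn}$ and induced coordinates $(t^a,x^i,p^a_i)$ changing by $\tilde t^a=\tilde t^a(t)$, $\tilde x^i=\tilde x^i(x)$, $\tilde p^a_i=\frac{\partial x^j}{\partial\tilde x^i}\frac{\partial\tilde t^a}{\partial t^b}p^b_j$. A nonlinear connection $N$ is a distribution on $E^*$ complementary to the vertical distribution $\mathcal W=\ker\pi^*{}_*$; locally it is spanned by $\frac{\delta}{\delta t^a}=\frac{\partial}{\partial t^a}-\underset{1}{N}{}^{(b)}_{(j)a}\frac{\partial}{\partial p^b_j}$ and $\frac{\delta}{\delta x^i}=\frac{\partial}{\partial x^i}-\underset{2}{N}{}^{(b)}_{(j)i}\frac{\partial}{\partial p^b_j}$, which together with $\frac{\partial}{\partial p^a_i}$ form the adapted basis. $\mathcal H_{\mathcal T},\mathcal H_M$ are the distributions spanned by $\delta/\delta t^a$ and $\delta/\delta x^i$. An $N$-linear connection is a linear connection $D$ on $E^*$ preserving by parallelism $\mathcal H_{\mathcal T},\mathcal H_M,\mathcal W$ (i.e. $D_X$ maps sections of each to sections of the same). Its curvature is $\mathbb R(X,Y)Z=D_XD_YZ-D_YD_XZ-D_{[X,Y]}Z$.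 A d-tensor on $E^*$ is a geometrical object with components $T=\left(T^{ai(k)(d)\dots}_{bj(c)(l)\dots}\right)$ transforming under coordinate changes on $E^*$ by $$T^{ai(k)(d)\dots}_{bj(c)(l)\dots}=\tilde T^{ep(r)(h)\dots}_{fq(g)(s)\dots}\frac{\partial t^a}{\partial\tilde t^e}\frac{\partial\tilde t^f}{\partial t^b}\frac{\partial x^i}{\partial\tilde x^p}\frac{\partial\tilde x^q}{\partial x^j}\left(\frac{\partial x^k}{\partial\tilde x^r}\frac{\partial\tilde t^g}{\partial t^c}\right)\left(\frac{\partial t^d}{\partial\tilde t^h}\frac{\partial\tilde x^s}{\partial x^l}\right)\cdots$$ *)

(* Defs.v *)
From HB Require Import structures.
From mathcomp Require Import all_boot all_order all_algebra.
From mathcomp Require Import all_classical all_reals all_analysis.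
Set Implicit Arguments.
Unset Strict Implicit.
Unset Printing Implicit Defensive.
Import Order.TTheory GRing.Theory Num.Theory.
Import numFieldNormedType.Exports.
Local Open Scope classical_set_scope.
Local Open Scope ring_scope.

Section Smooth.
Variables (R : realType) (V W : normedModType R).

(* Used on finite-dimensional spaces and open sets only, where it is the usual
   C^k: iterated directional derivatives exist and are continuous. *)
Fixpoint Ck (k : nat) (A : set V) (f : V -> W) : Prop :=
  match k with
  | 0 => forall x, A x -> {for x, continuous f}
  | k'.+1 => (forall x, A x -> differentiable f x) /\
             (forall v, Ck k' A (fun x => 'D_v f x))
  end.

Definition smooth_on (A : set V) (f : V -> W) : Prop := forall k, Ck k A f.

End Smooth.

Record chart (R : realType) (X : topologicalType) (V : normedModType R) :=
  Chart {
    cdom : set X;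
    cfun :> X -> V;
    cinv : V -> X;
    cdom_open : open cdom;
    cimg_open : open (cfun @` cdom);
    cfunK : forall u, cdom u -> cinv (cfun u) = u;
    cfun_cont : {within cdom, continuous cfun};
    cinv_cont : {within cfun @` cdom, continuous cinv} }.

Definition transition (R : realType) (X : topologicalType)
    (V : normedModType R) (c c' : chart X V) : V -> V :=
  fun y => c' (cinv c y).

(* A manifold is given with an atlas, maximal or not. *)
Record manifold (R : realType) (m : nat) := Manifold {
  mspace :> topologicalType;
  mhausdorff : hausdorff_space mspace;
  mcountable : @second_countable mspace;
  mindex : Type;
  mchart : mindex -> chart mspace 'rV[R]_m;
  mcover : forall t, exists i, cdom (mchart i) t;
  mcompat : forall i j,
    smooth_on (mchart i @` (cdom (mchart i) `&` cdom (mchart j)))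
              (transition (mchart i) (mchart j)) }.

(* With c, c' charts giving coordinates (z^a), (z'^b): the partial derivative
   of z'^b with respect to z^a, at the point t. *)
Definition partial (R : realType) (X : topologicalType) (m : nat)
    (c c' : chart X 'rV[R]_m) (t : X) (b a : 'I_m) : R :=
  ('D_(delta_mx 0 a) (transition c c') (c t)) 0 b.

Section VectorFields.
Variables (R : realType) (E : topologicalType) (V : normedModType R).
Variables (I : Type) (c : I -> chart E V).

(* X g u is the tuple of components, in the chart g, of the tangent vector at
   u. Only the values with u in the domain of g matter, and only those X
   which satisfy [is_vfield] on some open set U are vector fields (on U). *)
Definition vfield := I -> E -> V.

Definition vadd (X Y : vfield) : vfield := fun g u => X g u + Y g u.
Definition vopp (X : vfield) : vfield := fun g u => - X g u.
Definition vscale (f : E -> R) (X : vfield) : vfield := fun g u => f u *: X g u.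
Definition vsub (X Y : vfield) : vfield := vadd X (vopp Y).

Definition vfield_eq (U : set E) (X Y : vfield) : Prop :=
  forall g u, U u -> cdom (c g) u -> X g u = Y g u.

(* Components in g' of the tangent vector at u with components v in g. *)
Definition pushv (g g' : I) (u : E) (v : V) : V :=
  'D_v (transition (c g) (c g')) (c g u).

Definition is_vfield (U : set E) (X : vfield) : Prop :=
  forall g g' u, U u -> cdom (c g) u -> cdom (c g') u ->
    X g' u = pushv g g' u (X g u).

Definition smooth_fun (U : set E) (f : E -> R) : Prop :=
  forall g, smooth_on (c g @` (U `&` cdom (c g))) (fun y => f (cinv (c g) y)).

Definition smooth_vfield (U : set E) (X : vfield) : Prop :=
  is_vfield U X /\
  forall g, smooth_on (c g @` (U `&` cdom (c g))) (fun y => X g (cinv (c g) y)).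

(* X(f), computed in the chart g. *)
Definition vderiv (X : vfield) (f : E -> R) (g : I) (u : E) : R :=
  'D_(X g u) (fun y => f (cinv (c g) y)) (c g u).

(* [X, Y]^A = X^B d_B Y^A - Y^B d_B X^A in each chart. *)
Definition bracket (X Y : vfield) : vfield := fun g u =>
  'D_(X g u) (fun y => Y g (cinv (c g) y)) (c g u)
  - 'D_(Y g u) (fun y => X g (cinv (c g) y)) (c g u).

(* A linear connection as an operator on the sheaf of local smooth vector
   fields: [lc_local] says that D X Z over U only depends on X and Z over U. *)
Record linear_connection (D : vfield -> vfield -> vfield) : Prop := {
  lc_smooth : forall U X Z, open U ->
    smooth_vfield U X -> smooth_vfield U Z -> smooth_vfield U (D X Z);
  lc_local : forall U X X' Z Z', open U ->
    smooth_vfield U X -> smooth_vfield U X' ->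
    smooth_vfield U Z -> smooth_vfield U Z' ->
    vfield_eq U X X' -> vfield_eq U Z Z' -> vfield_eq U (D X Z) (D X' Z');
  lc_addl : forall U X X' Z, open U ->
    smooth_vfield U X -> smooth_vfield U X' -> smooth_vfield U Z ->
    vfield_eq U (D (vadd X X') Z) (vadd (D X Z) (D X' Z));
  lc_scalel : forall U f X Z, open U -> smooth_fun U f ->
    smooth_vfield U X -> smooth_vfield U Z ->
    vfield_eq U (D (vscale f X) Z) (vscale f (D X Z));
  lc_addr : forall U X Z Z', open U ->
    smooth_vfield U X -> smooth_vfield U Z -> smooth_vfield U Z' ->
    vfield_eq U (D X (vadd Z Z')) (vadd (D X Z) (D X Z'));
  lc_leibniz : forall U f X Z, open U -> smooth_fun U f ->
    smooth_vfield U X -> smooth_vfield U Z ->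
    vfield_eq U (D X (vscale f Z))
      (fun g u => vderiv X f g u *: Z g u + f u *: D X Z g u) }.

Definition curvature (D : vfield -> vfield -> vfield) (X Y Z : vfield)
    : vfield :=
  vsub (vsub (D X (D Y Z)) (D Y (D X Z))) (D (bracket X Y) Z).

(* A distribution: [S g u v] says that the tangent vector at u with components
   v in the chart g belongs to the distribution. *)
Definition distribution := I -> E -> set V.

Definition section_of (S : distribution) (U : set E) (Z : vfield) : Prop :=
  smooth_vfield U Z /\ forall g u, U u -> cdom (c g) u -> S g u (Z g u).

Definition preserves (D : vfield -> vfield -> vfield) (S : distribution)
    : Prop :=
  forall U X Z, open U -> smooth_vfield U X -> section_of S U Z ->
    section_of S U (D X Z).

(* The vector field, on the domain of g, with components v in the chart g. *)
Definition local_vfield (g : I) (v : E -> V) : vfield :=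
  fun g' u => pushv g g' u (v u).

End VectorFields.

(* Model space with points (t, x, p), p a i standing for p^a_i. *)
Definition jmodel (R : realType) (m n : nat) : normedModType R :=
  (('rV[R]_m * 'rV[R]_n) * 'M[R]_(m, n))%type.

(* J^1*(T, M) as the vector bundle with the prescribed transition functions;
   these determine it up to isomorphism. *)
Record dual_jet_bundle (R : realType) (m n : nat)
    (T : manifold R m) (M : manifold R n) := DualJetBundle {
  jspace :> topologicalType;
  jproj : jspace -> mspace T * mspace M;
  jchart : mindex T * mindex M -> chart jspace (jmodel R m n);
  jchart_dom : forall g, cdom (jchart g) =
    jproj @^-1` (cdom (mchart g.1) `*` cdom (mchart g.2));
  jchart_img : forall g, jchart g @` cdom (jchart g) =
    [set y | (mchart g.1 @` cdom (mchart g.1)) y.1.1 /\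
             (mchart g.2 @` cdom (mchart g.2)) y.1.2];
  jchart_base : forall g u, cdom (jchart g) u ->
    (jchart g u).1 = (mchart g.1 (jproj u).1, mchart g.2 (jproj u).2);
  jchart_fibre : forall g g' u, cdom (jchart g) u -> cdom (jchart g') u ->
    forall (a : 'I_m) (i : 'I_n),
    (jchart g' u).2 a i =
      \sum_(j < n) \sum_(b < m)
        partial (mchart g'.2) (mchart g.2) (jproj u).2 j i
        * partial (mchart g.1) (mchart g'.1) (jproj u).1 a b
        * (jchart g u).2 b j }.

Section JetGeometry.
Variables (R : realType) (m n : nat) (T : manifold R m) (M : manifold R n).
Variable E : dual_jet_bundle T M.

Let J := (mindex T * mindex M)%type.
Let V := jmodel R m n.
Let ch : J -> chart (jspace E) V := @jchart R m n T M E.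

Definition jvfield := vfield (jspace E) V J.

(* Kernel of the differential of the projection, the latter being read in the
   charts of the base that underlie g. *)
Definition vertical : distribution (jspace E) V J := fun g u =>
  [set v | 'D_v (fun y => let z := jproj (cinv (ch g) y) in
                   (mchart g.1 z.1, mchart g.2 z.2)) (ch g u)
           = 0 :> 'rV[R]_m * 'rV[R]_n].

(* nl_N1 g u a is the matrix with entries N1^(b)_(j)a at u in the chart g,
   and nl_N2 g u i the one with entries N2^(b)_(j)i; nl_span determines both
   of them from nl_hor. *)
Record nonlinear_connection := NonlinearConnection {
  nl_hor : distribution (jspace E) V J;
  nl_N1 : J -> jspace E -> 'I_m -> 'M[R]_(m, n);
  nl_N2 : J -> jspace E -> 'I_n -> 'M[R]_(m, n);
  nl_invariant : forall g g' u v, cdom (ch g) u -> cdom (ch g') u ->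
    nl_hor g u v -> nl_hor g' u (pushv ch g g' u v);
  nl_complement : forall g u v, cdom (ch g) u ->
    exists! hw : V * V,
      [/\ nl_hor g u hw.1, vertical g u hw.2 & v = hw.1 + hw.2];
  nl_N1_smooth : forall g a b j,
    smooth_fun ch (cdom (ch g)) (fun u => nl_N1 g u a b j);
  nl_N2_smooth : forall g i b j,
    smooth_fun ch (cdom (ch g)) (fun u => nl_N2 g u i b j);
  nl_span : forall g u v, cdom (ch g) u ->
    nl_hor g u v <->
    exists (s : 'I_m -> R) (y : 'I_n -> R),
      v = \sum_(a < m) s a *: ((delta_mx 0 a, 0, - nl_N1 g u a) : V)
          + \sum_(i < n) y i *: ((0, delta_mx 0 i, - nl_N2 g u i) : V) }.

Variable N : nonlinear_connection.

Definition delta_t_comp (g : J) (a : 'I_m) (u : jspace E) : V :=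
  (delta_mx 0 a, 0, - nl_N1 N g u a).
Definition delta_x_comp (g : J) (i : 'I_n) (u : jspace E) : V :=
  (0, delta_mx 0 i, - nl_N2 N g u i).
Definition d_p_comp (q : 'I_m * 'I_n) (u : jspace E) : V :=
  (0, 0, delta_mx q.1 q.2).

Definition delta_t (g : J) (a : 'I_m) : jvfield :=
  local_vfield ch g (delta_t_comp g a).
Definition delta_x (g : J) (i : 'I_n) : jvfield :=
  local_vfield ch g (delta_x_comp g i).
Definition d_p (g : J) (q : 'I_m * 'I_n) : jvfield :=
  local_vfield ch g (d_p_comp q).

Definition hor_t : distribution (jspace E) V J := fun g u =>
  [set v | exists s : 'I_m -> R, v = \sum_(a < m) s a *: delta_t_comp g a u].
Definition hor_x : distribution (jspace E) V J := fun g u =>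
  [set v | exists y : 'I_n -> R, v = \sum_(i < n) y i *: delta_x_comp g i u].

Definition N_linear_connection (D : jvfield -> jvfield -> jvfield) : Prop :=
  [/\ linear_connection ch D, preserves ch D hor_t, preserves ch D hor_x
    & preserves ch D vertical].

(* The types of indices: IT/IX for single temporal/spatial indices, IP for
   double ones. A double index is a pair (c, k), temporal index first:
   [IPlow] is ^(k)_(c), as in d/dp^c_k, and [IPup] is ^(d)_(l). *)
Inductive slot := ITup | ITlow | IXup | IXlow | IPup | IPlow.

Definition slot_idx (s : slot) : finType :=
  match s with
  | ITup | ITlow => 'I_m : finType
  | IXup | IXlow => 'I_n : finType
  | IPup | IPlow => ('I_m * 'I_n)%type : finType
  end.

Fixpoint multi_idx (s : seq slot) : Type :=
  match s with
  | [::] => unit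
  | k :: s' => (slot_idx k * multi_idx s')%type
  end.

(* Components in each chart, at each point. *)
Definition components (s : seq slot) := J -> jspace E -> multi_idx s -> R.

(* The factor relating the index i in the chart g and the index j in the
   chart g'; primes play the role of the tildes. *)
Definition slot_factor (g g' : J) (u : jspace E) (s : slot)
    : slot_idx s -> slot_idx s -> R :=
  let dt' f b := partial (mchart g.1) (mchart g'.1) (jproj u).1 f b in
  let dt a e := partial (mchart g'.1) (mchart g.1) (jproj u).1 a e in
  let dx' q j := partial (mchart g.2) (mchart g'.2) (jproj u).2 q j in
  let dx i p := partial (mchart g'.2) (mchart g.2) (jproj u).2 i p in
  match s return slot_idx s -> slot_idx s -> R with
  | ITup => fun i j => dt i j
  | ITlow => fun i j => dt' j i
  | IXup => fun i j => dx i j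
  | IXlow => fun i j => dx' j i
  | IPup => fun i j => dt i.1 j.1 * dx' j.2 i.2
  | IPlow => fun i j => dx i.2 j.2 * dt' j.1 i.1
  end.

Fixpoint tensor_sum (g g' : J) (u : jspace E) (s : seq slot)
    : (multi_idx s -> R) -> multi_idx s -> R :=
  match s return (multi_idx s -> R) -> multi_idx s -> R with
  | [::] => fun A _ => A tt
  | k :: s' => fun A I =>
      \sum_(j : slot_idx k) slot_factor g g' u I.1 j *
        tensor_sum g g' u (fun I' => A (j, I')) I.2
  end.

Definition d_tensor (s : seq slot) (A : components s) : Prop :=
  (forall g I, smooth_fun ch (cdom (ch g)) (fun u => A g u I)) /\
  (forall g g' u I, cdom (ch g) u -> cdom (ch g') u ->
     A g u I = tensor_sum g g' u (A g' u) I).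

(* The family of the basis vector to which the curvature is applied, ... *)
Inductive frame := Ft | Fx | Fp.
(* ... and those of its two arguments, the second argument coming first as in
   the order of the lower indices: Btx stands for R(d/dx^k, d/dt^b). *)
Inductive block := Btt | Btx | Btp | Bxx | Bxp | Bpp.

Definition frame_slots (z : frame) : seq slot :=
  match z with
  | Ft => [:: ITup; ITlow]
  | Fx => [:: IXup; IXlow]
  | Fp => [:: IPup; IPlow]
  end.

Definition block_slots (b : block) : seq slot :=
  match b with
  | Btt => [:: ITlow; ITlow]
  | Btx => [:: ITlow; IXlow]
  | Btp => [:: ITlow; IPlow]
  | Bxx => [:: IXlow; IXlow]
  | Bxp => [:: IXlow; IPlow]
  | Bpp => [:: IPlow; IPlow]
  end.

Definition curvature_components :=
  forall (z : frame) (b : block), components (frame_slots z ++ block_slots b).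

Local Notation ix4 i j k l := (i, (j, (k, (l, tt)))) (only parsing).

(* Multi-indices list the upper index of the output first, then the lower
   indices from left to right: R^l_ibc is at (l, i, b, c), and
   R^(d)(i)_(l)(a)bc at ((d, l), (a, i), b, c). *)
Definition curvature_equations (D : jvfield -> jvfield -> jvfield)
    (C : curvature_components) : Prop :=
  forall g : J,
  let eqs (X Y : jvfield) := vfield_eq ch (cdom (ch g)) X Y in
  let dt := delta_t g in
  let dx := delta_x g in
  let dp := d_p g in
  let Rm := curvature ch D in
  let comb_t (f : 'I_m -> jspace E -> R) : jvfield :=
    fun g' u => \sum_(d < m) f d u *: dt d g' u in
  let comb_x (f : 'I_n -> jspace E -> R) : jvfield :=
    fun g' u => \sum_(l < n) f l u *: dx l g' u in
  let comb_p (f : 'I_m -> 'I_n -> jspace E -> R) : jvfield :=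
    fun g' u => \sum_(d < m) \sum_(l < n) f d l u *: dp (d, l) g' u in
  ([/\ forall a b c, eqs (Rm (dt c) (dt b) (dt a))
         (comb_t (fun d u => C Ft Btt g u (ix4 d a b c))),
       forall i b c, eqs (Rm (dt c) (dt b) (dx i))
         (comb_x (fun l u => C Fx Btt g u (ix4 l i b c)))
     & forall a i b c, eqs (Rm (dt c) (dt b) (dp (a, i)))
         (comb_p (fun d l u => - C Fp Btt g u (ix4 (d, l) (a, i) b c)))]) /\
  ([/\ forall a b k, eqs (Rm (dx k) (dt b) (dt a))
         (comb_t (fun d u => C Ft Btx g u (ix4 d a b k))),
       forall i b k, eqs (Rm (dx k) (dt b) (dx i))
         (comb_x (fun l u => C Fx Btx g u (ix4 l i b k)))
     & forall a i b k, eqs (Rm (dx k) (dt b) (dp (a, i)))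
         (comb_p (fun d l u => - C Fp Btx g u (ix4 (d, l) (a, i) b k)))]) /\
  ([/\ forall a b c k, eqs (Rm (dp (c, k)) (dt b) (dt a))
         (comb_t (fun d u => C Ft Btp g u (ix4 d a b (c, k)))),
       forall i b c k, eqs (Rm (dp (c, k)) (dt b) (dx i))
         (comb_x (fun l u => C Fx Btp g u (ix4 l i b (c, k))))
     & forall a i b c k, eqs (Rm (dp (c, k)) (dt b) (dp (a, i)))
         (comb_p (fun d l u => - C Fp Btp g u (ix4 (d, l) (a, i) b (c, k))))]) /\
  ([/\ forall a j k, eqs (Rm (dx k) (dx j) (dt a))
         (comb_t (fun d u => C Ft Bxx g u (ix4 d a j k))),
       forall i j k, eqs (Rm (dx k) (dx j) (dx i))
         (comb_x (fun l u => C Fx Bxx g u (ix4 l i j k)))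
     & forall a i j k, eqs (Rm (dx k) (dx j) (dp (a, i)))
         (comb_p (fun d l u => - C Fp Bxx g u (ix4 (d, l) (a, i) j k)))]) /\
  ([/\ forall a j c k, eqs (Rm (dp (c, k)) (dx j) (dt a))
         (comb_t (fun d u => C Ft Bxp g u (ix4 d a j (c, k)))),
       forall i j c k, eqs (Rm (dp (c, k)) (dx j) (dx i))
         (comb_x (fun l u => C Fx Bxp g u (ix4 l i j (c, k))))
     & forall a i j c k, eqs (Rm (dp (c, k)) (dx j) (dp (a, i)))
         (comb_p (fun d l u => - C Fp Bxp g u (ix4 (d, l) (a, i) j (c, k))))]) /\
  ([/\ forall a b j c k, eqs (Rm (dp (c, k)) (dp (b, j)) (dt a))
         (comb_t (fun d u => C Ft Bpp g u (ix4 d a (b, j) (c, k)))),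
       forall i b j c k, eqs (Rm (dp (c, k)) (dp (b, j)) (dx i))
         (comb_x (fun l u => C Fx Bpp g u (ix4 l i (b, j) (c, k))))
     & forall a i b j c k, eqs (Rm (dp (c, k)) (dp (b, j)) (dp (a, i)))
         (comb_p (fun d l u =>
            - C Fp Bpp g u (ix4 (d, l) (a, i) (b, j) (c, k))))]).

End JetGeometry.

(* Main.v *)
Require Import Defs.
From HB Require Import structures.
From mathcomp Require Import all_boot all_order all_algebra.
From mathcomp Require Import all_classical all_reals all_analysis.

(** The curvature of a linear connection is tensorial: R(X, Y)Z is additive
    and homogeneous over smooth functions in each argument
    ([curvature_tensorial1], [curvature_tensorial2], [curvature_tensorial3]).
    For X and Y this is the Leibniz rule of the bracket, for Z it is the
    identity [X, Y] f = X(Y f) - Y(X f) ([vderiv_bracket]).  Hence, over a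
    chart domain, R is a combination of its values on any frame of vector
    fields ([curvature_expand]).

    The frame used is the adapted basis.  Three facts about it give the
    theorem.

    - D preserves the distributions spanned by the three families of the basis,
      hence so do the iterated derivatives that make up R(X, Y)
      ([curvature_section]).  So R(X, Y) maps a vector of one family to a
      combination of the same family, with unique coefficients: these are the
      components required, and they are smooth because they are coordinates of
      a smooth vector field.

    - Between two charts the adapted basis changes by a block diagonal matrix
      whose entries are the factors of the d-tensor law ([coord_adapted]).
      For the horizontal vectors this holds because the horizontal distribution
      does not depend on the chart, so that a horizontal vector is known from
      its projection to the base; for the vertical ones because a change of
      chart is linear in the fibres.  Expanding the three arguments in the
      frame of the other chart, and reading the value in the first one, yields
      the transformation law ([curv_coef_chart]).

    - The 18 tensors list the values of R on the frame up to exchanging the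
      first two arguments, which changes the sign.  So two connections with the
      same 18 tensors have the same curvature ([curvature_determined]).

    The analysis behind this is elementary.  Smoothness is stable under
    composition because, in finite dimension, a derivative in a variable
    direction is a combination of derivatives in fixed directions
    ([Ck_comp], [smooth_derive_dir]).  That the bracket of two vector fields is
    a vector field, and that it is the commutator of derivations, both follow
    from the symmetry of second derivatives ([derive_swap]) applied to
    [derive_moving_dir]. *)

Set Implicit Arguments.
Unset Strict Implicit.
Unset Printing Implicit Defensive.
Import Order.TTheory GRing.Theory Num.Theory.
Import numFieldNormedType.Exports.
Local Open Scope classical_set_scope.
Local Open Scope ring_scope.

(** * Directional derivatives *)

Section Differentiation.
Variables (R : realType) (V W : normedModType R).
Implicit Types (f g : V -> W) (A : set V) (x v : V).

Lemma near_eq_differentiable f g x :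
  {near x, f =1 g} -> differentiable f x -> differentiable g x.
Proof.
move=> fg /diff_locallyP [cdf dfE].
have gE : g \o shift x = cst (g x) + 'd f x +o_ 0 id.
  apply/eqaddoP => _/posnumP[e].
  move/eqaddoP : dfE => /(_ e%:num [gt0 of e%:num]) fe.
  have fg0 : \forall y \near 0, f (y + x) = g (y + x).
    by have := fg; rewrite (near_shift 0); apply: filterS => y /=; rewrite subr0.
  near=> y.
  suff -> : (g \o shift x - (cst (g x) + 'd f x)) y =
            (f \o shift x - (cst (f x) + 'd f x)) y by near: y.
  rewrite -![(_ - _ : _ -> _) _]/(_ - _) /= -(nbhs_singleton fg).
  by congr (_ - _); apply/esym; near: y.
have gd : 'd g x = 'd f x :> (V -> W) by apply: diff_unique.
by apply/diff_locallyP; rewrite gd.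
Unshelve. all: by end_near. Qed.

Lemma scale_is_bilinear :
  bilinear_for
    (GRing.Scale.Law.clone _ _ *:%R _) (GRing.Scale.Law.clone _ _ *:%R _)
    (@GRing.scale R W).
Proof.
split=> [u'|u] a x y /=.
- by rewrite scalerDl scalerA.
- by rewrite scalerDr !scalerA mulrC.
Qed.
HB.instance Definition _ := bilinear_isBilinear.Build R R W W _ _
  (@GRing.scale R W) scale_is_bilinear.

Lemma is_diff_scale (a : V -> R) f x :
  differentiable a x -> differentiable f x ->
  is_diff x (fun y => a y *: f y) (fun v => a x *: 'd f x v + 'd a x v *: f x).
Proof.
move=> da df.
have cs : continuous (fun p : R * W => p.1 *: p.2).
  exact: (@scale_continuous R W).
have db : differentiable (fun p : R * W => p.1 *: p.2) (a x, f x).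
  exact: (@differentiable_bilin R R W W _ (a x, f x) cs).
have dp := differentiable_pair da df.
split; first exact: (differentiable_comp dp db).
have -> : (fun y => a y *: f y) = (fun p => p.1 *: p.2) \o (fun y => (a y, f y)).
  by [].
rewrite diff_comp // (@diff_bilin R R W W _ (a x, f x) cs) diff_pair //.
Qed.

Lemma derive_scale (a : V -> R) f x v :
  differentiable a x -> differentiable f x ->
  'D_v (fun y => a y *: f y) x = 'D_v a x *: f x + a x *: 'D_v f x.
Proof.
move=> da df; have [d1 d2] := is_diff_scale da df.
by rewrite deriveE // d2 !deriveE // addrC.
Qed.

Lemma derive_linear (U : normedModType R) (l : {linear W -> U}) f x v :
  continuous l -> differentiable f x ->
  'D_v (fun y => l (f y)) x = l ('D_v f x).
Proof.
move=> cl df; have dl := linear_differentiable (f x) cl.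
rewrite deriveE; last exact: (differentiable_comp df dl).
by rewrite diff_comp // diff_lin // /= deriveE.
Qed.

(** A directional derivative only looks at the function along a line. *)
Lemma derive_along_line f x v (l : W) :
  (\forall h \near (0 : R), f (h *: v + x) = f x + h *: l) -> 'D_v f x = l.
Proof.
move=> fl; apply: cvg_lim => //.
apply: (@cvg_trans _ (cst l h @[h --> 0^'])); last exact: cvg_cst.
apply: near_eq_cvg; near=> h.
have h0 : h != 0 by near: h; exact: nbhs_dnbhs_neq.
rewrite /= (_ : f _ = f x + h *: l); first last.
  by near: h; apply: cvg_within; exact: fl.
by rewrite addrAC subrr add0r scalerA mulVf // scale1r.
Unshelve. all: by end_near. Qed.

Lemma derive_comp (U : normedModType R) (h : W -> U) f x v :
  differentiable f x -> differentiable h (f x) ->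
  'D_v (fun y => h (f y)) x = 'D_('D_v f x) h (f x).
Proof.
move=> df dh.
rewrite deriveE; last exact: (differentiable_comp df dh).
by rewrite diff_comp // [RHS]deriveE // /= deriveE.
Qed.

Lemma open_eq_near A f g x : open A -> A x -> {in A, f =1 g} ->
  {near x, f =1 g}.
Proof.
move=> oA Ax fg; have := open_nbhs_nbhs (conj oA Ax).
by apply: filterS => y Ay; apply: fg; rewrite inE.
Qed.

Lemma derive_congr A f g x v : open A -> A x -> {in A, f =1 g} ->
  'D_v f x = 'D_v g x.
Proof. by move=> oA Ax fg; apply/near_eq_derive/(open_eq_near oA Ax fg). Qed.

Lemma derive_dirD f x v w : differentiable f x ->
  'D_(v + w) f x = 'D_v f x + 'D_w f x.
Proof. by move=> df; rewrite !deriveE // linearD. Qed.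

Lemma derive_dirN f x v : differentiable f x -> 'D_(- v) f x = - 'D_v f x.
Proof. by move=> df; rewrite !deriveE // linearN. Qed.

Lemma derive_dirZ f x (a : R) v : differentiable f x ->
  'D_(a *: v) f x = a *: 'D_v f x.
Proof. by move=> df; rewrite !deriveE // linearZ. Qed.

Lemma derive_dir_sum f x (K : finType) (a : K -> R) (v : K -> V) :
  differentiable f x ->
  'D_(\sum_k a k *: v k) f x = \sum_k a k *: 'D_(v k) f x.
Proof.
move=> df; rewrite deriveE // linear_sum.
by apply: eq_bigr => k _; rewrite linearZ deriveE.
Qed.

Lemma derive_bigsum (K : finType) (f : K -> V -> W) x v :
  (forall j, differentiable (f j) x) ->
  'D_v (fun y => \sum_j f j y) x = \sum_j 'D_v (f j) x.
Proof.
move=> df; suff [] : differentiable (fun y => \sum_j f j y) x /\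
  'D_v (fun y => \sum_j f j y) x = \sum_j 'D_v (f j) x by [].
elim: (index_enum K) => [|j s [ds Es]].
  have -> : (fun y => \sum_(j <- [::]) f j y) = cst 0.
    by apply/funext => y; rewrite big_nil.
  by split; [exact: differentiable_cst|rewrite big_nil derive_cst].
have -> : (fun y => \sum_(i <- j :: s) f i y) =
    f j + (fun y => \sum_(i <- s) f i y).
  by apply/funext => y; rewrite big_cons.
split; first exact: differentiableD.
by rewrite big_cons -Es deriveD //; exact: diff_derivable.
Qed.

End Differentiation.

(** * Smooth maps between finite-dimensional spaces *)

(** Finite dimension is only used through such a family: it allows a
    derivative in a variable direction to be written with derivatives in fixed
    ones. *)
Record coordinates (R : realType) (V : normedModType R) := Coordinates {
  co_idx : finType;
  co_vec : co_idx -> V;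
  co_fun : co_idx -> {linear V -> R};
  co_cont : forall j, continuous (co_fun j);
  co_decomp : forall v, v = \sum_j co_fun j v *: co_vec j }.
Arguments co_vec {R V} c j.
Arguments co_fun {R V} c j.
Arguments co_cont {R V} c j.
Arguments co_decomp {R V} c v.

Section SmoothClosure.
Variable R : realType.
Implicit Types V W U : normedModType R.

Lemma Ck_sub V W k (A B : set V) (f : V -> W) :
  A `<=` B -> Ck k B f -> Ck k A f.
Proof.
move=> AB; elim: k f => [|k IH] f /= => [fB x /AB|[dB cB]]; first exact: fB.
by split=> [x /AB|v]; [exact: dB|apply/IH/cB].
Qed.

Lemma Ck_congr V W k (A : set V) (f g : V -> W) : open A -> {in A, f =1 g} ->
  Ck k A f -> Ck k A g.
Proof.
move=> oA; elim: k f g => [|k IH] f g fg /= => [fA x Ax|[dA cA]].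
  have nfg := open_eq_near oA Ax fg.
  have cf : f y @[y --> x] --> f x := fA x Ax.
  rewrite (nbhs_singleton nfg) in cf.
  exact: (cvg_trans (near_eq_cvg nfg) cf).
split=> [x Ax|v]; first exact: (near_eq_differentiable (open_eq_near oA Ax fg) (dA x Ax)).
apply: IH (cA v) => x; rewrite inE => Ax; exact: (derive_congr _ oA Ax fg).
Qed.

Lemma CkW V W k (A : set V) (f : V -> W) : Ck k.+1 A f -> Ck k A f.
Proof.
elim: k f => [|k IH] f [dA cA] => [x Ax|].
  exact: (differentiable_continuous (dA x Ax)).
by split=> // v; exact: IH (cA v).
Qed.

Lemma Ck_cst V W k (A : set V) (a : W) : Ck k A (fun=> a).
Proof.
elim: k a => [|k IH] a /= => [x _|]; first exact: cst_continuous.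
split=> [x _|v]; first exact: differentiable_cst.
suff -> : (fun x : V => 'D_v (fun=> a) x) = (fun=> 0) by exact: IH.
by apply/funext => x; exact: derive_cst.
Qed.

Lemma CkD V W k (A : set V) (f g : V -> W) : open A ->
  Ck k A f -> Ck k A g -> Ck k A (fun x => f x + g x).
Proof.
move=> oA; elim: k f g => [|k IH] f g /= => [fA gA x Ax|[df cf] [dg cg]].
  by apply: continuousD; [exact: fA|exact: gA].
split=> [x Ax|v].
  by apply: differentiableD; [exact: df|exact: dg].
apply: Ck_congr (IH _ _ (cf v) (cg v)) => // x; rewrite inE => Ax.
by rewrite -deriveD //; apply: diff_derivable; [exact: df|exact: dg].
Qed.

Lemma Ck_linear V W U k (A : set V) (f : V -> W) (l : {linear W -> U}) :
  open A -> continuous l -> Ck k A f -> Ck k A (fun x => l (f x)).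
Proof.
move=> oA cl; elim: k f => [|k IH] f /= => [fA x Ax|[df cf]].
  by apply: continuous_comp; [exact: fA|exact: cl].
split=> [x Ax|v].
  exact: (differentiable_comp (df x Ax) (linear_differentiable _ cl)).
apply: Ck_congr (IH _ (cf v)) => // x; rewrite inE => Ax.
by rewrite derive_linear //; exact: df.
Qed.

Lemma Ck_scale V W k (A : set V) (a : V -> R) (f : V -> W) : open A ->
  Ck k A a -> Ck k A f -> Ck k A (fun x => a x *: f x).
Proof.
move=> oA; elim: k a f => [|k IH] a f /=.
  move=> aA fA x Ax.
  exact: (cvgZ (aA x Ax) (fA x Ax)).
move=> aA fA; have [[da ca] [df cf]] := (aA, fA).
split=> [x Ax|v]; first by have [] := is_diff_scale (da x Ax) (df x Ax).
have ck := CkD oA (IH _ _ (ca v) (CkW fA)) (IH _ _ (CkW aA) (cf v)).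
apply: Ck_congr ck => // x; rewrite inE => Ax.
by rewrite derive_scale //; [exact: da|exact: df].
Qed.

Lemma Ck_sum V W k (A : set V) (K : finType) (f : K -> V -> W) : open A ->
  (forall i, Ck k A (f i)) -> Ck k A (fun x => \sum_i f i x).
Proof.
move=> oA fA; elim: (index_enum K) => [|i s IH].
  suff -> : (fun x => \sum_(i <- [::]) f i x) = (fun=> 0) by exact: Ck_cst.
  by apply/funext => x; rewrite big_nil.
suff -> : (fun x => \sum_(i <- i :: s) f i x) =
    (fun x => f i x + \sum_(i <- s) f i x) by exact: CkD.
by apply/funext => x; rewrite big_cons.
Qed.

(** By the chain rule the derivative of a composite is a combination, with
    coefficients the coordinates of the derivative of the inner map, of
    derivatives of the outer map in constant directions: this is where the
    finite dimension is used. *)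
Lemma Ck_comp V W U (b : coordinates W) k (A : set V) (B : set W)
    (f : V -> W) (h : W -> U) :
  open A -> (forall x, A x -> B (f x)) -> Ck k A f -> Ck k B h ->
  Ck k A (fun x => h (f x)).
Proof.
move=> oA fAB; elim: k h => [|k IH] h.
  move=> fA hB x Ax.
  by apply: continuous_comp; [exact: fA|exact: hB (fAB _ Ax)].
move=> fA hB; have [[df cf] [dh ch]] := (fA, hB).
split=> [x Ax|v].
  exact: (differentiable_comp (df x Ax) (dh _ (fAB _ Ax))).
have ck : Ck k A (fun x => \sum_j co_fun b j ('D_v f x) *:
    'D_(co_vec b j) h (f x)).
  apply: Ck_sum => // j; apply: Ck_scale => //.
    exact: (Ck_linear oA (co_cont b j) (cf v)).
  by apply: IH (ch _) => //; exact: CkW.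
apply: Ck_congr ck => // x; rewrite inE => Ax.
have [dfx dhx] := (df x Ax, dh _ (fAB _ Ax)).
by rewrite (derive_comp v dfx dhx) [in RHS](co_decomp b ('D_v f x)) derive_dir_sum.
Qed.

Section SmoothOn.
Variables (V W : normedModType R).
Implicit Types (f g : V -> W) (A B : set V).

Lemma smooth_sub A B f : A `<=` B -> smooth_on B f -> smooth_on A f.
Proof. by move=> AB fB k; exact: (Ck_sub AB (fB k)). Qed.

Lemma smooth_congr A f g : open A -> {in A, f =1 g} ->
  smooth_on A f -> smooth_on A g.
Proof. by move=> oA fg fA k; exact: (Ck_congr oA fg (fA k)). Qed.

Lemma smooth_diff A f x : smooth_on A f -> A x -> differentiable f x.
Proof. by move=> /(_ 1) [df _] /df. Qed.

Lemma smooth_derive A f v : smooth_on A f -> smooth_on A ('D_v f).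
Proof. by move=> fA k; have [_ cf] := fA k.+1; exact: cf. Qed.

Lemma smooth_cst A (a : W) : smooth_on A (fun=> a : W).
Proof. by move=> k; exact: Ck_cst. Qed.

Lemma smoothD A f g : open A -> smooth_on A f -> smooth_on A g ->
  smooth_on A (fun x => f x + g x).
Proof. by move=> oA fA gA k; exact: CkD. Qed.

Lemma smooth_linear A f (U : normedModType R) (l : {linear W -> U}) : open A ->
  continuous l -> smooth_on A f -> smooth_on A (fun x => l (f x)).
Proof. by move=> oA cl fA k; exact: Ck_linear. Qed.

Lemma smooth_scale A (a : V -> R) f : open A -> smooth_on A a ->
  smooth_on A f -> smooth_on A (fun x => a x *: f x).
Proof. by move=> oA aA fA k; exact: Ck_scale. Qed.

Lemma smooth_sum A (K : finType) (f : K -> V -> W) : open A ->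
  (forall i, smooth_on A (f i)) -> smooth_on A (fun x => \sum_i f i x).
Proof. by move=> oA fA k; apply: Ck_sum => // i; exact: fA. Qed.

Lemma smoothN A f : open A -> smooth_on A f -> smooth_on A (fun x => - f x).
Proof.
move=> oA fA; have s1 : smooth_on A (fun=> -1 : R) by move=> k; exact: Ck_cst.
by apply: (smooth_congr oA _ (smooth_scale oA s1 fA)) => x _; rewrite scaleN1r.
Qed.

End SmoothOn.

Lemma smooth_id V (b : coordinates V) (A : set V) : open A -> smooth_on A id.
Proof.
move=> oA [|k]; first by move=> x _ B.
split=> [x _|v]; first exact: ex_diff.
suff -> : (fun x : V => 'D_v id x) = (fun=> v) by exact: Ck_cst.
by apply/funext => x; rewrite derive_id.
Qed.

Lemma smooth_comp V W U (b : coordinates W) (A : set V) (B : set W)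
    (f : V -> W) (h : W -> U) :
  open A -> (forall x, A x -> B (f x)) -> smooth_on A f -> smooth_on B h ->
  smooth_on A (fun x => h (f x)).
Proof. by move=> oA fAB fA hB k; exact: (Ck_comp b oA fAB). Qed.

(** Same idea as for composites: the moving direction is expanded. *)
Lemma smooth_derive_dir V W (b : coordinates V) (A : set V) (f : V -> W)
    (G : V -> V) :
  open A -> smooth_on A f -> smooth_on A G ->
  smooth_on A (fun x => 'D_(G x) f x).
Proof.
move=> oA fA GA.
have sm : smooth_on A (fun x => \sum_j co_fun b j (G x) *: 'D_(co_vec b j) f x).
  apply: smooth_sum => // j; apply: smooth_scale => //.
    exact: (smooth_linear oA (co_cont b j)).
  exact: smooth_derive.
apply: smooth_congr sm => // x; rewrite inE => Ax.
have dfx := smooth_diff fA Ax.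
by rewrite [in RHS](co_decomp b (G x)) derive_dir_sum.
Qed.

Lemma smooth_coord V W (b : coordinates W) (A : set V) (f : V -> W) : open A ->
  (forall j, smooth_on A (fun x => co_fun b j (f x))) -> smooth_on A f.
Proof.
move=> oA fA; rewrite (_ : f = fun x => \sum_j co_fun b j (f x) *: co_vec b j).
  by apply: smooth_sum => // j; apply: smooth_scale => //; exact: smooth_cst.
by apply/funext => x; exact: co_decomp.
Qed.

End SmoothClosure.

(** * Symmetry of second derivatives *)

Section Schwarz.
Variables (R : realType) (V : normedModType R).

Lemma is_derive_line (F : V -> R) (v y : V) (s : R) :
  differentiable F (s *: v + y) ->
  is_derive s (1 : R) (fun r => F (r *: v + y)) ('D_v F (s *: v + y)).
Proof.
move=> dF; have dv := @diff_derivable _ _ _ F _ v dF.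
have E : (fun h : R => h^-1 *: (((fun r => F (r *: v + y)) \o shift s) (h *: 1)
           - F (s *: v + y))) =
         (fun h => h^-1 *: ((F \o shift (s *: v + y)) (h *: v) - F (s *: v + y))).
  apply/funext => h /=; congr (_ *: (F _ - _)).
  by rewrite [h *: 1]mulr1 scalerDl addrA.
split; first by rewrite /derivable E.
by rewrite /derive E.
Qed.

(** Two applications of the mean value theorem to the second difference of F
    over the parallelogram with sides h v and h w. *)
Lemma second_difference (A : set V) (F P : V -> R) (v w x : V) (h : R) :
  smooth_on A F -> 'D_w ('D_v F) = P -> 0 < h ->
  (forall s t, 0 <= s <= h -> 0 <= t <= h -> A (s *: v + t *: w + x)) ->
  exists s t, [/\ 0 <= s <= h, 0 <= t <= h &
    F (h *: v + h *: w + x) - F (h *: v + x) - F (h *: w + x) + F x =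
    P (s *: v + t *: w + x) * h * h].
Proof.
move=> FA <- h0 hA.
have A0 s : 0 <= s <= h -> A (s *: v + x).
  move=> sh; have := hA s 0 sh; rewrite lexx ltW //= => /(_ isT).
  by rewrite scale0r addr0.
have dF y : A y -> differentiable F y := smooth_diff FA.
have dDF y : A y -> differentiable ('D_v F) y := smooth_diff (smooth_derive v FA).
pose phi (s : R) := F (s *: v + (h *: w + x)) - F (s *: v + x).
pose dphi (s : R) := 'D_v F (s *: v + (h *: w + x)) - 'D_v F (s *: v + x).
have dphiE s : 0 <= s <= h -> is_derive s (1 : R) phi (dphi s).
  move=> sh; apply: is_deriveB; apply: is_derive_line; apply: dF.
    by rewrite addrA; apply: hA => //; rewrite lexx ltW.
  exact: A0.
have [s /andP [s0 sh] Es] : exists2 s, 0 <= s <= h & phi h - phi 0 = dphi s * (h - 0).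
  have dE r : r \in `]0, h[ -> is_derive r (1 : R) phi (dphi r).
    by rewrite in_itv /= => /andP [/ltW a /ltW b]; apply: dphiE; rewrite a.
  have cE : {within `[0, h], continuous phi}.
    apply: derivable_within_continuous => r.
    by rewrite in_itv /= => rh; have [] := dphiE _ rh.
  have [s sh Es] := MVT h0 dE cE.
  exists s => //; move: sh; rewrite in_itv /= => /andP [/ltW a /ltW b].
  by rewrite a.
pose psi (t : R) := 'D_v F (t *: w + (s *: v + x)).
pose dpsi (t : R) := 'D_w ('D_v F) (t *: w + (s *: v + x)).
have dpsiE t : 0 <= t <= h -> is_derive t (1 : R) psi (dpsi t).
  move=> th; apply: is_derive_line; apply: dDF.
  by rewrite addrCA addrA; apply: hA => //; rewrite s0.
have [t th Et] : exists2 t, 0 <= t <= h & psi h - psi 0 = dpsi t * (h - 0).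
  have dE r : r \in `]0, h[ -> is_derive r (1 : R) psi (dpsi r).
    by rewrite in_itv /= => /andP [/ltW a /ltW b]; apply: dpsiE; rewrite a.
  have cE : {within `[0, h], continuous psi}.
    apply: derivable_within_continuous => r.
    by rewrite in_itv /= => rh; have [] := dpsiE _ rh.
  have [t th Et] := MVT h0 dE cE.
  exists t => //; move: th; rewrite in_itv /= => /andP [/ltW a /ltW b].
  by rewrite a.
exists s, t; split=> //; first by rewrite s0.
have -> : s *: v + t *: w + x = t *: w + (s *: v + x) by rewrite addrCA addrA.
move: Es Et; rewrite !subr0 /phi /dphi /psi !scale0r !add0r => Es Et.
rewrite -/(dpsi t) -Et [h *: w + (s *: v + x)]addrCA -Es opprB.
by rewrite -addrA [- F (h *: w + x) + _]addrC -[h *: v + h *: w + x]addrA.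
Qed.

Lemma nbhs_parallelogram (P : set V) (x v w : V) : nbhs x P ->
  exists2 h : R, 0 < h &
    forall s t, 0 <= s <= h -> 0 <= t <= h -> P (s *: v + t *: w + x).
Proof.
move=> /nbhs_ballP [d /= d0 dP].
have n1 : 0 < `|v| + `|w| + 1 by rewrite ltr_wpDl // addr_ge0.
exists (d / (`|v| + `|w| + 1)); first by rewrite divr_gt0.
move=> s t /andP [s0 sh] /andP [t0 th]; apply: dP.
rewrite -ball_normE /= opprD addrCA subrr addr0 normrN.
apply: (le_lt_trans (ler_normD _ _)); rewrite !normrZ !ger0_norm //.
have -> : d = d / (`|v| + `|w| + 1) * (`|v| + `|w| + 1) by rewrite divfK ?gt_eqF.
rewrite [ltRHS]mulrDr mulr1 [_ * (`|v| + `|w|)]mulrDr.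
by rewrite ltr_pwDr ?divr_gt0 // lerD // ler_wpM2r.
Qed.

(** Used with d a second difference, which both mixed derivatives express at
    some point of the same small parallelogram. *)
Lemma eq_of_parallelograms (P Q : V -> R) (A : set V) (x v w : V) : nbhs x A ->
  {for x, continuous P} -> {for x, continuous Q} ->
  (forall h, 0 < h ->
    (forall s t, 0 <= s <= h -> 0 <= t <= h -> A (s *: v + t *: w + x)) ->
    exists d s t, [/\ 0 <= s <= h, 0 <= t <= h & d = P (s *: v + t *: w + x) * h * h] /\
    exists s t, [/\ 0 <= s <= h, 0 <= t <= h & d = Q (s *: v + t *: w + x) * h * h]) ->
  P x = Q x.
Proof.
move=> nA cP cQ PQ.
apply/eqP; rewrite -subr_eq0 -normr_le0; apply/ler_addgt0Pl => e e0.
rewrite addr0.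
have e2 : 0 < e / 2 by rewrite divr_gt0.
have n1 : nbhs x [set y | `|P x - P y| < e / 2].
  by move: cP => /cvgrPdist_lt /(_ _ e2).
have n2 : nbhs x [set y | `|Q x - Q y| < e / 2].
  by move: cQ => /cvgrPdist_lt /(_ _ e2).
have [h h0 hP] := nbhs_parallelogram v w (filterI nA (filterI n1 n2)).
have hA s t : 0 <= s <= h -> 0 <= t <= h -> A (s *: v + t *: w + x).
  by move=> sh th; have [] := hP s t sh th.
have [d [s' [t' [[sh' th' E1] [s [t [sh th E2]]]]]]] := PQ h h0 hA.
have E : P (s' *: v + t' *: w + x) = Q (s *: v + t *: w + x).
  by apply/(mulIf (lt0r_neq0 h0))/(mulIf (lt0r_neq0 h0)); rewrite -E1.
have [_ [/= p1 _]] := hP s' t' sh' th'.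
have [_ [_ /= p2]] := hP s t sh th.
rewrite -(subrKA (P (s' *: v + t' *: w + x))) {2}E.
apply: (le_trans (ler_normD _ _)); rewrite [leRHS]splitr; apply: lerD.
  exact: ltW.
by rewrite distrC ltW.
Qed.

Lemma derive_swap_real (A : set V) (F : V -> R) (v w x : V) :
  open A -> smooth_on A F -> A x -> 'D_v ('D_w F) x = 'D_w ('D_v F) x.
Proof.
move=> oA FA Ax.
have cc a b : {for x, continuous ('D_a ('D_b F))}.
  exact: (smooth_derive a (smooth_derive b FA) 0%N).
(* Only the continuity at x of the two mixed derivatives, and the formula for
   the second difference, are used from here on. *)
suff gen P Q : 'D_v ('D_w F) = P -> 'D_w ('D_v F) = Q ->
    {for x, continuous P} -> {for x, continuous Q} -> P x = Q x.
  exact: (gen _ _ erefl erefl (cc v w) (cc w v)).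
move=> PE QE cP cQ; apply: (@eq_of_parallelograms _ _ A x v w _ cP cQ).
  exact: open_nbhs_nbhs.
move=> h h0 hA.
exists (F (h *: v + h *: w + x) - F (h *: v + x) - F (h *: w + x) + F x).
have hA' s t : 0 <= s <= h -> 0 <= t <= h -> A (s *: w + t *: v + x).
  by move=> sh th; rewrite [s *: w + _]addrC; exact: hA.
have [t [s [th sh E]]] := second_difference FA PE h0 hA'.
exists s, t; split; last exact: (second_difference FA QE h0 hA).
split=> //; rewrite [s *: v + _]addrC -E [h *: w + h *: v]addrC.
by congr (_ + _); rewrite addrAC.
Qed.

(** A vector valued map is reduced to its coordinates, to which the mean value
    theorem applies. *)
Lemma derive_swap (W : normedModType R) (b : coordinates W) (A : set V)
    (F : V -> W) (v w x : V) :
  open A -> smooth_on A F -> A x -> 'D_v ('D_w F) x = 'D_w ('D_v F) x.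
Proof.
move=> oA FA Ax.
have coordE u u' j : co_fun b j ('D_u ('D_u' F) x) =
    'D_u ('D_u' (fun y => co_fun b j (F y))) x.
  rewrite -(derive_linear u (co_cont b j)).
    apply: (derive_congr u oA Ax) => y; rewrite inE => Ay.
    by rewrite (derive_linear u' (co_cont b j)) //; exact: smooth_diff FA Ay.
  exact: smooth_diff (smooth_derive u' FA) Ax.
rewrite (co_decomp b ('D_v _ x)) [RHS](co_decomp b); apply: eq_bigr => j _.
rewrite !coordE (derive_swap_real v w oA _ Ax) //.
exact: (smooth_linear oA (co_cont b j)).
Qed.

End Schwarz.

Section MovingDirection.
Variables (R : realType) (V W : normedModType R) (b : coordinates V).

(** The direction G y is expanded in coordinates, and the product rule applies.
    By [derive_swap] the first term is symmetric in v and G x, so that it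
    disappears from brackets and commutators. *)
Lemma derive_moving_dir (A : set V) (F : V -> W) (G : V -> V) (v x : V) :
  open A -> smooth_on A F -> smooth_on A G -> A x ->
  'D_v (fun y => 'D_(G y) F y) x = 'D_v ('D_(G x) F) x + 'D_('D_v G x) F x.
Proof.
move=> oA FA GA Ax.
have dF y : A y -> differentiable F y := smooth_diff FA.
have dDF u y : A y -> differentiable ('D_u F) y :=
  smooth_diff (smooth_derive u FA).
have expand (H : V -> V) y : A y ->
    'D_(H y) F y = \sum_j co_fun b j (H y) *: 'D_(co_vec b j) F y.
  by move=> /dF dy; rewrite {1}(co_decomp b (H y)) derive_dir_sum.
have dc j : differentiable (fun y => co_fun b j (G y)) x.
  exact: smooth_diff (smooth_linear oA (co_cont b j) GA) Ax.
rewrite (derive_congr v oA Ax (g := fun y =>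
    \sum_j co_fun b j (G y) *: 'D_(co_vec b j) F y)); last first.
  by move=> y; rewrite inE; exact: expand.
rewrite derive_bigsum => [|j]; last first.
  by have [] := is_diff_scale (dc j) (dDF (co_vec b j) x Ax).
under eq_bigr => j _.
  rewrite derive_scale //; last exact: dDF.
  rewrite (derive_linear v (co_cont b j)); last exact: smooth_diff GA Ax.
over.
rewrite big_split /= addrC; congr (_ + _); last first.
  by rewrite [in RHS](co_decomp b ('D_v G x)) derive_dir_sum //; exact: dF.
rewrite (derive_congr v oA Ax (f := 'D_(G x) F) (g := fun y =>
    \sum_j co_fun b j (G x) *: 'D_(co_vec b j) F y)); last first.
  move=> y; rewrite inE => Ay.
  by rewrite {1}(co_decomp b (G x)) derive_dir_sum //; exact: dF.
rewrite derive_bigsum => [|j]; last first.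
  by apply: differentiableZ; exact: dDF.
apply: eq_bigr => j _; rewrite deriveZ //.
by apply: diff_derivable; exact: dDF.
Qed.

End MovingDirection.

(** * Vector fields in an atlas *)

Lemma regroup_second_differences (W : zmodType) (x x' y y' z z' : W) :
  x + x' - (y + y') - (z + z') = x - y - z + (x' - y' - z').
Proof. by rewrite !opprD (addrACA x) (addrACA (x - y)). Qed.

Lemma regroup_scaled_field (R : pzRingType) (W : lmodType R) (f q : R)
    (x y z w : W) :
  f *: x - (q *: w + f *: y) - (f *: z + - q *: w) = f *: (x - y - z).
Proof.
rewrite scaleNr !scalerBr opprD opprB addrA; congr (_ - _).
by rewrite addrA addrAC subrK.
Qed.

Lemma regroup_second_leibniz (R : pzRingType) (W : lmodType R)
    (f p q r s : R) (x y z u v w : W) :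
  r *: w + q *: u + (p *: v + f *: x) - (s *: w + p *: v + (q *: u + f *: y))
  - ((r - s) *: w + f *: z) = f *: (x - y - z).
Proof.
have -> : r *: w + q *: u + (p *: v + f *: x) =
    r *: w + (p *: v + q *: u) + f *: x by rewrite -!addrA (addrCA (q *: u)).
have -> : s *: w + p *: v + (q *: u + f *: y) =
    s *: w + (p *: v + q *: u) + f *: y by rewrite !addrA.
rewrite opprD addrACA opprD (addrACA (r *: w)) subrr addr0 -scalerBl.
by rewrite opprD addrACA subrr add0r -!scalerBr.
Qed.

Section Atlas.
Variables (R : realType) (E : topologicalType) (V : normedModType R).
Variables (b : coordinates V) (I : Type) (c : I -> chart E V).
Hypothesis smooth_transition : forall g g',
  smooth_on (c g @` (cdom (c g) `&` cdom (c g'))) (transition (c g) (c g')).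

Implicit Types (U : set E) (X Y Z : vfield E V I) (f : E -> R) (g : I).

Local Notation dom g := (cdom (c g)).
Local Notation img g U := (c g @` (U `&` cdom (c g))).
Local Notation tr g g' := (transition (c g) (c g')).
Local Notation push := (pushv c).
Local Notation SF := (smooth_fun c).
Local Notation SV := (smooth_vfield c).
Local Notation "X ~[ U ] Y" := (vfield_eq c U X Y) (at level 70).

Lemma mem_img U g u : U u -> dom g u -> img g U (c g u).
Proof. by move=> Uu gu; exists u. Qed.

Lemma open_img U g : open U -> open (img g U).
Proof.
move=> oU; rewrite openE => _ [u [Uu gu] <-].
have oi := cimg_open (c g); have ci := @cinv_cont _ _ _ (c g).
rewrite continuous_open_subspace // in ci.
have iu : (c g @` cdom (c g)) (c g u) by exists u.
have nU : nbhs (cinv (c g) (c g u)) (U `&` dom g).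
  rewrite cfunK //; apply: filterI; apply: open_nbhs_nbhs; split=> //.
  exact: cdom_open.
have {}ci : {for c g u, continuous (cinv (c g))} by apply: ci; rewrite inE.
have nU' : nbhs (c g u) (cinv (c g) @^-1` (U `&` dom g)) := ci _ nU.
have niu : nbhs (c g u) (cinv (c g) @^-1` (U `&` dom g) `&` c g @` dom g).
  by apply: filterI => //; exact: open_nbhs_nbhs.
apply: filterS niu => y [/= Uy [w gw wy]]; move: Uy; rewrite -wy cfunK // => Uw.
by exists w.
Qed.

Lemma img_sub U U' g : U `<=` U' -> img g U `<=` img g U'.
Proof. by move=> UU _ [u [Uu gu] <-]; exists u; split=> //; exact: UU. Qed.

Lemma transitionE g g' u : dom g u -> tr g g' (c g u) = c g' u.
Proof. by move=> gu; rewrite /transition cfunK. Qed.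

Lemma smooth_tr U g g' : smooth_on (img g (U `&` dom g')) (tr g g').
Proof.
apply: (smooth_sub _ (smooth_transition g g')) => _ [u [[Uu g'u] gu] <-].
by exists u.
Qed.

Lemma img_tr U g g' y : img g (U `&` dom g') y -> img g' (U `&` dom g) (tr g g' y).
Proof.
by move=> [u [[Uu g'u] gu] <-]; rewrite transitionE //; exact: mem_img.
Qed.

Lemma diff_tr g g' u : dom g u -> dom g' u -> differentiable (tr g g') (c g u).
Proof. by move=> gu g'u; apply: (smooth_diff (smooth_transition g g')); exists u. Qed.

Lemma open_dom g : open (dom g). Proof. exact: cdom_open. Qed.

Lemma push_id g u v : dom g u -> push g g u v = v.
Proof.
move=> gu; rewrite /pushv.
rewrite (derive_congr (g := id) v (@open_img setT g openT)
  (@mem_img setT g u Logic.I gu)).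
  by rewrite derive_id.
by move=> y; rewrite inE => -[w [_ gw] <-]; rewrite transitionE.
Qed.

(** Chain rule for a change of chart.  F is a function, the components of a
    vector field in a fixed chart, or a chart. *)
Lemma derive_push (W : normedModType R) (F : E -> W) U g g' u v : open U -> U u ->
  dom g u -> dom g' u -> differentiable (fun y => F (cinv (c g') y)) (c g' u) ->
  'D_(push g g' u v) (fun y => F (cinv (c g') y)) (c g' u) =
  'D_v (fun y => F (cinv (c g) y)) (c g u).
Proof.
move=> oU Uu gu g'u dF.
rewrite -(transitionE g' gu) in dF *.
rewrite -[LHS](derive_comp v (diff_tr gu g'u) dF).
have oA : open (img g (U `&` dom g')) by apply/open_img/openI/open_dom.
apply: (derive_congr v oA (mem_img _ gu)) => // y; rewrite inE.
by move=> [w [[Uw g'w] gw] <-]; rewrite transitionE // !cfunK.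
Qed.

Lemma push_comp g g' g'' u v : dom g u -> dom g' u -> dom g'' u ->
  push g' g'' u (push g g' u v) = push g g'' u v.
Proof.
move=> gu g'u g''u; rewrite {1}/pushv /transition.
by apply: (derive_push (F := c g'') v openT Logic.I gu g'u); exact: diff_tr.
Qed.

Lemma push_sum g g' u (K : finType) (a : K -> R) (v : K -> V) :
  dom g u -> dom g' u ->
  push g g' u (\sum_k a k *: v k) = \sum_k a k *: push g g' u (v k).
Proof. by move=> gu g'u; rewrite /pushv derive_dir_sum //; exact: diff_tr. Qed.

Lemma pushZ g g' u a v : dom g u -> dom g' u ->
  push g g' u (a *: v) = a *: push g g' u v.
Proof. by move=> gu g'u; apply: derive_dirZ; exact: diff_tr. Qed.

Lemma pushD g g' u v w : dom g u -> dom g' u ->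
  push g g' u (v + w) = push g g' u v + push g g' u w.
Proof. by move=> gu g'u; apply: derive_dirD; exact: diff_tr. Qed.

Lemma pushN g g' u v : dom g u -> dom g' u ->
  push g g' u (- v) = - push g g' u v.
Proof. by move=> gu g'u; apply: derive_dirN; exact: diff_tr. Qed.

Lemma smooth_fun_chart U g f : open U -> U `<=` dom g ->
  smooth_on (img g U) (fun y => f (cinv (c g) y)) -> SF U f.
Proof.
move=> oU Ug fU g'.
have E1 : img g' U = img g' (U `&` dom g).
  by congr (_ @` (_ `&` _)); apply/esym/setIidl.
have oA : open (img g' (U `&` dom g)) by apply/open_img/openI/open_dom.
rewrite E1.
have sm : smooth_on (img g' (U `&` dom g)) (fun y => f (cinv (c g) (tr g' g y))).
  apply: (smooth_comp b oA _ (smooth_tr U g' g) fU) => y /img_tr.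
  by apply: img_sub; exact: subIsetl.
apply: (smooth_congr oA _ sm) => y; rewrite inE => -[u [[Uu gu] g'u] <-].
by rewrite transitionE // !cfunK.
Qed.

Lemma smooth_vfield_chart U g X : open U -> U `<=` dom g -> is_vfield c U X ->
  smooth_on (img g U) (fun y => X g (cinv (c g) y)) -> SV U X.
Proof.
move=> oU Ug vX XU; split=> // g'.
have E1 : img g' U = img g' (U `&` dom g).
  by congr (_ @` (_ `&` _)); apply/esym/setIidl.
have oA : open (img g' (U `&` dom g)) by apply/open_img/openI/open_dom.
have oB : open (img g (U `&` dom g')) by apply/open_img/openI/open_dom.
rewrite E1.
pose H z := 'D_(X g (cinv (c g) z)) (tr g g') z.
have sm : smooth_on (img g' (U `&` dom g)) (fun y => H (tr g' g y)).
  apply: (smooth_comp b oA (@img_tr U g' g) (smooth_tr U g' g)).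
  apply: (smooth_derive_dir b oB (smooth_tr U g g')).
  by apply: (smooth_sub _ XU); apply: img_sub; exact: subIsetl.
apply: (smooth_congr oA _ sm) => y; rewrite inE => -[u [[Uu gu] g'u] <-].
by rewrite /H transitionE // !cfunK // (vX g g' u).
Qed.

Lemma local_is_vfield g (v : E -> V) : is_vfield c (dom g) (local_vfield c g v).
Proof. by move=> g' g'' u gu g'u g''u; rewrite /local_vfield push_comp. Qed.

Lemma smooth_local_vfield g (v : E -> V) :
  smooth_on (img g (dom g)) (fun y => v (cinv (c g) y)) ->
  SV (dom g) (local_vfield c g v).
Proof.
move=> sv; have oA : open (img g (dom g)) by apply/open_img/open_dom.
apply: (smooth_vfield_chart (g := g)) => //; first exact: open_dom.
  exact: local_is_vfield.
apply: (smooth_congr oA _ sv) => y; rewrite inE => -[u [_ gu] <-].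
by rewrite /local_vfield push_id ?cfunK.
Qed.

Lemma smooth_vfield_sub U U' X : U' `<=` U -> SV U X -> SV U' X.
Proof.
move=> UU [vX sX]; split=> [g g' u U'u|g]; first by apply: vX; exact: UU.
exact: (smooth_sub (img_sub UU) (sX g)).
Qed.

Lemma smooth_fun_sub U U' f : U' `<=` U -> SF U f -> SF U' f.
Proof. by move=> UU fU g; exact: (smooth_sub (img_sub UU) (fU g)). Qed.

Lemma smooth_vadd U X Y : open U -> SV U X -> SV U Y -> SV U (vadd X Y).
Proof.
move=> oU [vX sX] [vY sY]; split=> [g g' u Uu gu g'u|g].
  by rewrite /vadd pushD // (vX g g') // (vY g g').
by apply: smoothD; [exact: open_img|exact: sX|exact: sY].
Qed.

Lemma smooth_vopp U X : open U -> SV U X -> SV U (vopp X).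
Proof.
move=> oU [vX sX]; split=> [g g' u Uu gu g'u|g].
  by rewrite /vopp pushN // (vX g g').
by apply: smoothN; [exact: open_img|exact: sX].
Qed.

Lemma smooth_vsub U X Y : open U -> SV U X -> SV U Y -> SV U (vsub X Y).
Proof. by move=> oU sX sY; apply: smooth_vadd => //; exact: smooth_vopp. Qed.

Lemma smooth_vscale U f X : open U -> SF U f -> SV U X -> SV U (vscale f X).
Proof.
move=> oU sf [vX sX]; split=> [g g' u Uu gu g'u|g].
  by rewrite /vscale pushZ // (vX g g').
by apply: smooth_scale; [exact: open_img|exact: sf|exact: sX].
Qed.

Lemma smooth_fun_cst U (a : R) : SF U (fun=> a).
Proof. by move=> g; exact: smooth_cst. Qed.

Lemma smooth_vzero U : SV U (fun _ _ => 0).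
Proof.
split=> [g g' u Uu gu g'u|g]; last exact: smooth_cst.
by rewrite -[X in push _ _ _ X](scale0r (0 : V)) pushZ // scale0r.
Qed.

Lemma diff_vfield U X g u : SV U X -> U u -> dom g u ->
  differentiable (fun y => X g (cinv (c g) y)) (c g u).
Proof. by move=> [_ sX] Uu gu; apply: (smooth_diff (sX g)); exact: mem_img. Qed.

Lemma diff_fun U f g u : SF U f -> U u -> dom g u ->
  differentiable (fun y => f (cinv (c g) y)) (c g u).
Proof. by move=> sf Uu gu; apply: (smooth_diff (sf g)); exact: mem_img. Qed.

Lemma vderiv_chart U X f g g' u : open U -> SV U X -> SF U f -> U u ->
  dom g u -> dom g' u -> vderiv c X f g' u = vderiv c X f g u.
Proof.
move=> oU [vX _] sf Uu gu g'u; rewrite /vderiv (vX g g' u) //.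
by rewrite (derive_push (F := f) _ oU Uu gu g'u) //; exact: diff_fun sf Uu g'u.
Qed.

Lemma smooth_vderiv U X f g : open U -> U `<=` dom g -> SV U X -> SF U f ->
  SF U (vderiv c X f g).
Proof.
move=> oU Ug [_ sX] sf; apply: (smooth_fun_chart (g := g) oU Ug).
have oA := @open_img U g oU.
apply: (smooth_congr oA _ (smooth_derive_dir b oA (sf g) (sX g))) => y.
by rewrite inE => -[u [Uu gu] <-]; rewrite /vderiv cfunK.
Qed.

(** The components of a vector field are not functions of the point alone:
    differentiating the change of components adds a second derivative of the
    transition map. *)
Lemma derive_components U Y g g' u v : open U -> SV U Y -> U u -> dom g u ->
  dom g' u ->
  'D_(push g g' u v) (fun z => Y g' (cinv (c g') z)) (c g' u) =
  'D_v ('D_(Y g u) (tr g g')) (c g u)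
  + push g g' u ('D_v (fun z => Y g (cinv (c g) z)) (c g u)).
Proof.
move=> oU sY Uu gu g'u; have [vY _] := sY.
have oA : open (img g (U `&` dom g')) by apply/open_img/openI/open_dom.
have Au : img g (U `&` dom g') (c g u) by apply: mem_img.
rewrite (derive_push (F := Y g') _ oU Uu gu g'u) //; last exact: diff_vfield sY Uu g'u.
rewrite (derive_congr v oA Au (g := fun y => 'D_(Y g (cinv (c g) y)) (tr g g') y)).
  rewrite (derive_moving_dir (G := fun y => Y g (cinv (c g) y)) b v oA
    (smooth_tr U g g') _ Au) ?cfunK //.
  by have [_ cY] := sY; apply: (smooth_sub _ (cY g)); apply: img_sub; exact: subIsetl.
move=> y; rewrite inE => -[w [[Uw g'w] gw] <-].
by rewrite cfunK // (vY g g').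
Qed.

(** By [derive_components] the terms that are not the components of a vector
    are second derivatives of the transition map; they cancel by symmetry. *)
Lemma smooth_bracket U X Y : open U -> SV U X -> SV U Y ->
  SV U (bracket c X Y).
Proof.
move=> oU sX sY; have [[vX cX] [vY cY]] := (sX, sY).
split=> [g g' u Uu gu g'u|g].
  have Au : img g (U `&` dom g') (c g u) by apply: mem_img.
  have oA : open (img g (U `&` dom g')) by apply/open_img/openI/open_dom.
  rewrite /bracket (vX g g' u) // (vY g g' u) //.
  rewrite (derive_components _ oU sY Uu gu g'u).
  rewrite (derive_components _ oU sX Uu gu g'u).
  rewrite (derive_swap b (X g u) (Y g u) oA (smooth_tr U g g') Au).
  by rewrite opprD addrACA subrr add0r -pushN // -pushD.
have oA := @open_img U g oU.
have sm := smoothD oA (smooth_derive_dir b oA (cY g) (cX g))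
  (smoothN oA (smooth_derive_dir b oA (cX g) (cY g))).
apply: (smooth_congr oA _ sm) => y.
by rewrite inE => -[u [Uu gu] <-]; rewrite /bracket cfunK.
Qed.

Lemma bracket_local U X X' Y Y' : open U -> X ~[U] X' -> Y ~[U] Y' ->
  bracket c X Y ~[U] bracket c X' Y'.
Proof.
move=> oU XX YY g u Uu gu; have Au := mem_img Uu gu.
have cong Z Z' v : Z ~[U] Z' -> 'D_v (fun y => Z g (cinv (c g) y)) (c g u) =
    'D_v (fun y => Z' g (cinv (c g) y)) (c g u).
  move=> ZZ; apply: (derive_congr v (@open_img U g oU) Au) => y.
  by rewrite inE => -[w [Uw gw] <-]; rewrite cfunK // ZZ.
by rewrite /bracket XX // YY // (cong _ _ _ XX) (cong _ _ _ YY).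
Qed.

Lemma bracketC X Y : bracket c Y X = vopp (bracket c X Y).
Proof. by apply/funext => g; apply/funext => u; rewrite /vopp opprB. Qed.

Lemma bracket_addl U X X' Y : SV U X -> SV U X' -> SV U Y ->
  bracket c (vadd X X') Y ~[U] vadd (bracket c X Y) (bracket c X' Y).
Proof.
move=> sX sX' sY g u Uu gu; rewrite /bracket /vadd.
rewrite derive_dirD; last exact: diff_vfield sY Uu gu.
rewrite deriveD; try by apply: diff_derivable; apply: diff_vfield Uu gu.
by rewrite opprD addrACA.
Qed.

Lemma bracket_scalel U f X Y : SF U f -> SV U X -> SV U Y ->
  bracket c (vscale f X) Y ~[U]
  fun g u => f u *: bracket c X Y g u - vderiv c Y f g u *: X g u.
Proof.
move=> sf sX sY g u Uu gu; rewrite /bracket /vscale.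
rewrite derive_dirZ; last exact: diff_vfield sY Uu gu.
rewrite derive_scale; [|exact: diff_fun sf Uu gu|exact: diff_vfield sX Uu gu].
by rewrite cfunK // opprD scalerBr -/(vderiv c Y f g u) addrA addrAC.
Qed.

(** The second derivatives of f cancel by symmetry, and the derivatives of the
    components of X and Y are those of the bracket. *)
Lemma vderiv_bracket U f X Y g : open U -> U `<=` dom g ->
  SF U f -> SV U X -> SV U Y ->
  forall u, U u -> vderiv c (bracket c X Y) f g u =
    vderiv c X (vderiv c Y f g) g u - vderiv c Y (vderiv c X f g) g u.
Proof.
move=> oU Ug sf sX sY u Uu; have gu := Ug u Uu.
have Au := mem_img Uu gu; have oA := @open_img U g oU.
have dfu := diff_fun sf Uu gu.
have second Z Z' : SV U Z -> SV U Z' -> vderiv c Z (vderiv c Z' f g) g u =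
    'D_(Z g u) ('D_(Z' g u) (fun y => f (cinv (c g) y))) (c g u)
    + 'D_('D_(Z g u) (fun y => Z' g (cinv (c g) y)) (c g u))
         (fun y => f (cinv (c g) y)) (c g u).
  move=> sZ [_ sZ']; rewrite {1}/vderiv.
  rewrite (derive_congr _ oA Au (g := fun y =>
    'D_(Z' g (cinv (c g) y)) (fun y => f (cinv (c g) y)) y)).
    by rewrite (derive_moving_dir b _ oA (sf g) (sZ' g) Au) cfunK.
  by move=> y; rewrite inE => -[w [Uw gw] <-]; rewrite /vderiv cfunK.
rewrite (second X Y) // (second Y X) //.
rewrite (derive_swap_real (X g u) (Y g u) oA (sf g) Au).
rewrite opprD addrACA subrr add0r.
by rewrite /vderiv /bracket derive_dirD // derive_dirN.
Qed.


(** * Tensoriality of the curvature *)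

Definition tensorial U (F : vfield E V I -> vfield E V I) : Prop :=
  [/\ forall X X', SV U X -> SV U X' -> X ~[U] X' -> F X ~[U] F X',
      forall X X', SV U X -> SV U X' -> F (vadd X X') ~[U] vadd (F X) (F X')
    & forall f X, SF U f -> SV U X -> F (vscale f X) ~[U] vscale f (F X)].

Definition combination (K : finType) (a : K -> E -> R) (e : K -> vfield E V I)
    : vfield E V I := fun g u => \sum_k a k u *: e k g u.

Lemma tensorial_combination U (F : vfield E V I -> vfield E V I) (K : finType)
    (a : K -> E -> R) (e : K -> vfield E V I) X : open U -> tensorial U F ->
  (forall k, SF U (a k)) -> (forall k, SV U (e k)) -> SV U X ->
  X ~[U] combination a e -> F X ~[U] combination a (fun k => F (e k)).
Proof.
move=> oU [Floc Fadd Fscale] sa se sX XE.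
pose sum s : vfield E V I := fun g u => \sum_(k <- s) a k u *: e k g u.
have Fsum s : SV U (sum s) /\
    F (sum s) ~[U] fun g u => \sum_(k <- s) a k u *: F (e k) g u.
  elim: s => [|k s [sS FS]].
    have -> : sum [::] = vscale (fun=> 0) (fun _ _ => 0).
      by apply/funext => g; apply/funext => u; rewrite /sum big_nil /vscale scaler0.
    split; first exact/smooth_vscale/smooth_vzero/smooth_fun_cst.
    move=> g u Uu gu; rewrite big_nil.
    by rewrite Fscale ?/vscale ?scale0r //; [exact: smooth_fun_cst|exact: smooth_vzero].
  have -> : sum (k :: s) = vadd (vscale (a k) (e k)) (sum s).
    by apply/funext => g; apply/funext => u; rewrite /sum big_cons.
  have sk : SV U (vscale (a k) (e k)) by exact: smooth_vscale.
  split; first exact: smooth_vadd.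
  by move=> g u Uu gu; rewrite Fadd // /vadd FS // Fscale // big_cons.
have [sS FS] := Fsum (index_enum K).
by move=> g u Uu gu; rewrite (Floc _ _ sX sS XE) // FS.
Qed.

Section Curvature.
Variable D : vfield E V I -> vfield E V I -> vfield E V I.
Hypothesis connD : linear_connection c D.
Local Notation Rm := (curvature c D).

Lemma smooth_curvature U X Y Z : open U -> SV U X -> SV U Y -> SV U Z ->
  SV U (Rm X Y Z).
Proof.
move=> oU sX sY sZ; have sB := smooth_bracket oU sX sY.
have sD A B := @lc_smooth _ _ _ _ _ _ connD U A B oU.
apply: (smooth_vsub oU _ (sD _ _ sB sZ)).
exact: (smooth_vsub oU (sD _ _ sX (sD _ _ sY sZ)) (sD _ _ sY (sD _ _ sX sZ))).
Qed.

Lemma curvature_local U X X' Y Y' Z Z' : open U ->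
  SV U X -> SV U X' -> SV U Y -> SV U Y' -> SV U Z -> SV U Z' ->
  X ~[U] X' -> Y ~[U] Y' -> Z ~[U] Z' -> Rm X Y Z ~[U] Rm X' Y' Z'.
Proof.
move=> oU sX sX' sY sY' sZ sZ' XX YY ZZ g u Uu gu.
have sD A B := @lc_smooth _ _ _ _ _ _ connD U A B oU.
have sB A B := @smooth_bracket U A B oU.
have lD A A' B B' := @lc_local _ _ _ _ _ _ connD U A A' B B' oU.
have lB := bracket_local oU XX YY.
have l1 := lD _ _ _ _ sX sX' (sD _ _ sY sZ) (sD _ _ sY' sZ') XX
  (lD _ _ _ _ sY sY' sZ sZ' YY ZZ).
have l2 := lD _ _ _ _ sY sY' (sD _ _ sX sZ) (sD _ _ sX' sZ') YY
  (lD _ _ _ _ sX sX' sZ sZ' XX ZZ).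
have l3 := lD _ _ _ _ (sB _ _ sX sY) (sB _ _ sX' sY') sZ sZ' lB ZZ.
by rewrite /curvature /vsub /vadd /vopp l1 // l2 // l3.
Qed.

Lemma curvature_antisym U X Y Z : open U -> SV U X -> SV U Y -> SV U Z ->
  Rm Y X Z ~[U] vopp (Rm X Y Z).
Proof.
move=> oU sX sY sZ g u Uu gu; have sB := smooth_bracket oU sX sY.
have BN : bracket c Y X = vscale (fun=> -1) (bracket c X Y).
  rewrite bracketC; apply/funext => h; apply/funext => w.
  by rewrite /vscale scaleN1r.
rewrite /curvature BN /vsub /vadd /vopp.
rewrite (lc_scalel connD oU (smooth_fun_cst U (-1)) sB sZ) // /vscale scaleN1r.
by rewrite !opprD !opprK [- D X _ _ _ + _]addrC.
Qed.

(** The derivative of f along Y enters twice: from D Y (f D X Z), and from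
    [f X, Y] = f [X, Y] - Y(f) X.  The two contributions cancel. *)
Lemma curvature_tensorial1 U Y Z g0 : open U -> U `<=` dom g0 -> SV U Y ->
  SV U Z -> tensorial U (fun X => Rm X Y Z).
Proof.
move=> oU Ug sY sZ.
have sD A B := @lc_smooth _ _ _ _ _ _ connD U A B oU.
have sB A := @smooth_bracket U A Y oU.
have lD A A' B B' := @lc_local _ _ _ _ _ _ connD U A A' B B' oU.
split=> [X X' sX sX' XX|X X' sX sX'|f X sf sX] g u Uu gu.
- exact: (curvature_local oU sX sX' sY sY sZ sZ XX).
- rewrite /curvature /vsub /vopp.
  have sDX := sD _ _ sX sZ; have sDX' := sD _ _ sX' sZ.
  have sXX := smooth_vadd oU sX sX'.
  have e1 := lc_addl connD oU sX sX' (sD _ _ sY sZ).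
  have e2 := lD _ _ _ _ sY sY (sD _ _ sXX sZ) (smooth_vadd oU sDX sDX')
    (fun _ _ _ _ => erefl) (lc_addl connD oU sX sX' sZ).
  have e2' := lc_addr connD oU sY sDX sDX'.
  have e3 := lD _ _ _ _ (sB _ sXX sY) (smooth_vadd oU (sB _ sX sY) (sB _ sX' sY))
    sZ sZ (bracket_addl sX sX' sY) (fun _ _ _ _ => erefl).
  have e3' := lc_addl connD oU (sB _ sX sY) (sB _ sX' sY) sZ.
  rewrite {1 2 3}/vadd e1 // e2 // e2' // e3 // e3' // /vadd.
  exact: regroup_second_differences.
rewrite /curvature /vsub /vopp.
have sDX := sD _ _ sX sZ; have sfX := smooth_vscale oU sf sX.
have gu0 := Ug u Uu.
pose h := fun w => - vderiv c Y f g0 w.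
have sh : SF U h.
  move=> g'; apply: smoothN; first exact: open_img.
  exact: (smooth_vderiv oU Ug sY sf).
have hE w g' : U w -> dom g' w -> h w = - vderiv c Y f g' w.
  by move=> Uw g'w; rewrite /h (vderiv_chart (g := g0) oU sY sf Uw (Ug w Uw) g'w).
have BE : bracket c (vscale f X) Y ~[U] vadd (vscale f (bracket c X Y)) (vscale h X).
  move=> g' w Uw g'w; rewrite (bracket_scalel sf sX sY) // /vadd /vscale.
  by rewrite (hE w g') // scaleNr.
have e1 := lc_scalel connD oU sf sX (sD _ _ sY sZ).
have e2 := lD _ _ _ _ sY sY (sD _ _ sfX sZ) (smooth_vscale oU sf sDX)
    (fun _ _ _ _ => erefl) (lc_scalel connD oU sf sX sZ).
have e2' := lc_leibniz connD oU sf sY sDX.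
have s1 := smooth_vscale oU sf (sB _ sX sY); have s2 := smooth_vscale oU sh sX.
have e3 := lD _ _ _ _ (sB _ sfX sY) (smooth_vadd oU s1 s2) sZ sZ BE
  (fun _ _ _ _ => erefl).
have e3' := lc_addl connD oU s1 s2 sZ.
rewrite {1 2 3}/vadd e1 // e2 // e2' // e3 // e3' // {1}/vadd.
rewrite (lc_scalel connD oU sf (sB _ sX sY) sZ) //.
rewrite (lc_scalel connD oU sh sX sZ) // /vscale (hE u g) //.
exact: regroup_scaled_field.
Qed.

Lemma curvature_tensorial2 U X Z g0 : open U -> U `<=` dom g0 -> SV U X ->
  SV U Z -> tensorial U (fun Y => Rm X Y Z).
Proof.
move=> oU Ug sX sZ; have [_ tadd tscale] := curvature_tensorial1 oU Ug sX sZ.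
split=> [Y Y' sY sY' YY|Y Y' sY sY'|f Y sf sY] g u Uu gu.
- exact: (curvature_local oU sX sX sY sY' sZ sZ _ YY).
- rewrite (curvature_antisym oU (smooth_vadd oU sY sY') sX sZ) // /vopp tadd //.
  by rewrite /vadd opprD (curvature_antisym oU sY sX) // (curvature_antisym oU sY' sX).
rewrite (curvature_antisym oU (smooth_vscale oU sf sY) sX sZ) // /vopp tscale //.
by rewrite /vscale (curvature_antisym oU sY sX) // scalerN.
Qed.

(** The first order terms in f cancel because they are symmetric in X and Y,
    the second order ones because [X, Y] f = X(Y f) - Y(X f). *)
Lemma curvature_tensorial3 U X Y g0 : open U -> U `<=` dom g0 -> SV U X ->
  SV U Y -> tensorial U (Rm X Y).
Proof.
move=> oU Ug sX sY.
have sD A B := @lc_smooth _ _ _ _ _ _ connD U A B oU.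
have sB := smooth_bracket oU sX sY.
have lD A B B' sA sB sB' := @lc_local _ _ _ _ _ _ connD U A A B B' oU sA sA sB sB'
  (fun _ _ _ _ => erefl).
split=> [Z Z' sZ sZ' ZZ|Z Z' sZ sZ'|f Z sf sZ] g u Uu gu.
- exact: (curvature_local oU sX sX sY sY sZ sZ' _ _ ZZ).
- rewrite /curvature /vsub /vopp {1 2 4 5}/vadd.
  have sZZ := smooth_vadd oU sZ sZ'.
  have second A B : SV U A -> SV U B -> D A (D B (vadd Z Z')) ~[U]
      vadd (D A (D B Z)) (D A (D B Z')).
    move=> sA sB' g' w Uw g'w.
    rewrite (lD _ _ _ sA (sD _ _ sB' sZZ)
      (smooth_vadd oU (sD _ _ sB' sZ) (sD _ _ sB' sZ')) (lc_addr connD oU sB' sZ sZ')) //.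
    exact: (lc_addr connD oU sA (sD _ _ sB' sZ) (sD _ _ sB' sZ')).
  rewrite (second X Y) // (second Y X) // (lc_addr connD oU sB sZ sZ') // /vadd.
  exact: regroup_second_differences.
have gu0 := Ug u Uu.
have second A B : SV U A -> SV U B -> D A (D B (vscale f Z)) ~[U]
    fun g w => vderiv c A (vderiv c B f g0) g0 w *: Z g w
      + vderiv c B f g0 w *: D A Z g w
      + (vderiv c A f g0 w *: D B Z g w + f w *: D A (D B Z) g w).
  move=> sA sB' g' w Uw g'w; have g0w := Ug w Uw.
  have sh := smooth_vderiv oU Ug sB' sf.
  have sBZ := sD _ _ sB' sZ.
  have E1 : D B (vscale f Z) ~[U] vadd (vscale (vderiv c B f g0) Z) (vscale f (D B Z)).
    move=> g1 v Uv g1v; rewrite (lc_leibniz connD oU sf sB' sZ) // /vadd /vscale.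
    by rewrite (vderiv_chart (g := g0) oU sB' sf Uv (Ug v Uv) g1v).
  have s1 := smooth_vscale oU sh sZ; have s2 := smooth_vscale oU sf sBZ.
  rewrite (lD _ _ _ sA (sD _ _ sB' (smooth_vscale oU sf sZ))
    (smooth_vadd oU s1 s2) E1) //.
  rewrite (lc_addr connD oU sA s1 s2) // /vadd.
  rewrite (lc_leibniz connD oU sh sA sZ) // (lc_leibniz connD oU sf sA sBZ) //.
  rewrite (vderiv_chart (g := g0) oU sA sf Uw g0w g'w).
  by rewrite (vderiv_chart (g := g0) oU sA sh Uw g0w g'w).
rewrite /curvature /vsub /vopp {1 2}/vadd (second X Y) // (second Y X) //.
rewrite (lc_leibniz connD oU sf sB sZ) // {1}/vscale /vadd.
rewrite (vderiv_chart (g := g0) oU sB sf Uu gu0 gu).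
rewrite (vderiv_bracket oU Ug sf sX sY) //.
exact: regroup_second_leibniz.
Qed.

(** On the domain of a chart a frame exists, and the trilinear curvature is
    known from its values on that frame. *)
Lemma curvature_expand U g0 (K : finType) (e : K -> vfield E V I)
    (p q r : K -> E -> R) X Y Z :
  open U -> U `<=` dom g0 -> (forall k, SV U (e k)) ->
  (forall k, SF U (p k)) -> (forall k, SF U (q k)) -> (forall k, SF U (r k)) ->
  SV U X -> SV U Y -> SV U Z ->
  X ~[U] combination p e -> Y ~[U] combination q e -> Z ~[U] combination r e ->
  Rm X Y Z ~[U] fun g u => \sum_i \sum_j \sum_k
    p i u *: (q j u *: (r k u *: Rm (e i) (e j) (e k) g u)).
Proof.
move=> oU Ug se sp sq sr sX sY sZ XE YE ZE g u Uu gu.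
rewrite (tensorial_combination oU (curvature_tensorial1 oU Ug sY sZ) sp se sX XE) //.
apply: eq_bigr => i _.
rewrite (tensorial_combination oU (curvature_tensorial2 oU Ug (se i) sZ) sq se sY YE) //.
rewrite /combination scaler_sumr; apply: eq_bigr => j _.
rewrite (tensorial_combination oU (curvature_tensorial3 oU Ug (se i) (se j))
  sr se sZ ZE) //.
by rewrite /combination !scaler_sumr.
Qed.

End Curvature.
End Atlas.

(** * Coordinates of the model space *)

Section ModelCoordinates.
Variable R : realType.

Definition mx_entry m n (i : 'I_m) (j : 'I_n) (A : 'M[R]_(m, n)) : R := A i j.

Lemma mx_entry_is_linear m n i j : linear (@mx_entry m n i j).
Proof. by move=> a A B; rewrite /mx_entry !mxE. Qed.
HB.instance Definition _ m n i j := GRing.isLinear.Build R 'M[R]_(m, n) R _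
  (@mx_entry m n i j) (@mx_entry_is_linear m n i j).

Lemma mx_entry_decomp m n (A : 'M[R]_(m, n)) :
  A = \sum_(q : 'I_m * 'I_n) mx_entry q.1 q.2 A *: delta_mx q.1 q.2.
Proof. by rewrite [LHS]matrix_sum_delta pair_big. Qed.

Definition mx_coordinates m n : coordinates 'M[R]_(m, n) :=
  @Coordinates R 'M[R]_(m, n) ('I_m * 'I_n)%type (fun q => delta_mx q.1 q.2)
    (fun q => @mx_entry m n q.1 q.2) (fun q => @coord_continuous R m n q.1 q.2)
    (@mx_entry_decomp m n).

Section Product.
Variables (V W : normedModType R) (b : coordinates V) (b' : coordinates W).

Definition prod_fun (k : co_idx b + co_idx b') : {linear (V * W)%type -> R} :=
  match k with inl j => co_fun b j \o fst | inr j => co_fun b' j \o snd end.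

Definition prod_vec (k : co_idx b + co_idx b') : (V * W)%type :=
  match k with inl j => (co_vec b j, 0) | inr j => (0, co_vec b' j) end.

Lemma prod_cont k : continuous (prod_fun k).
Proof.
case: k => j x /=; apply: continuous_comp.
- exact: cvg_fst.
- exact: co_cont.
- exact: cvg_snd.
- exact: co_cont.
Qed.

Lemma sum_pair (K : finType) (f : K -> V) (h : K -> W) :
  \sum_k (f k, h k) = (\sum_k f k, \sum_k h k).
Proof.
by apply: (big_rec3 (fun x y z => x = (y, z))) => // k x y z _ ->.
Qed.

Lemma prod_decomp v : v = \sum_k prod_fun k v *: prod_vec k.
Proof.
case: v => v w; rewrite big_sumType /=.
have -> : \sum_j co_fun b j v *: ((co_vec b j, 0) : (V * W)%type) = (v, 0).
  rewrite [in RHS](co_decomp b v).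
  rewrite -[X in (_, X)](@big1_eq _ 0 +%R _ (index_enum (co_idx b)) xpredT).
  rewrite -sum_pair; apply: eq_bigr => j _.
  by rewrite [LHS]/GRing.scale /= /scale_pair/= scaler0.
have -> : \sum_j co_fun b' j w *: ((0, co_vec b' j) : (V * W)%type) = (0, w).
  rewrite [in RHS](co_decomp b' w).
  rewrite -[X in (X, _)](@big1_eq _ 0 +%R _ (index_enum (co_idx b')) xpredT).
  rewrite -sum_pair; apply: eq_bigr => j _.
  by rewrite [LHS]/GRing.scale /= /scale_pair/= scaler0.
by rewrite [RHS]/GRing.add /= /add_pair /= addr0 add0r.
Qed.

Definition prod_coordinates : coordinates (V * W)%type :=
  @Coordinates R (V * W)%type (co_idx b + co_idx b')%type prod_vec prod_fun
    prod_cont prod_decomp.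

Lemma smooth_pair (U : normedModType R) (A : set U) (f : U -> V) (h : U -> W) :
  open A -> smooth_on A f -> smooth_on A h ->
  smooth_on A (fun x => (f x, h x)).
Proof.
move=> oA fA hA; apply: (smooth_coord (b := prod_coordinates) oA) => -[j|j] /=.
  exact: (smooth_linear oA (co_cont b j)).
exact: (smooth_linear oA (co_cont b' j)).
Qed.

End Product.

Lemma smooth_mx (U : normedModType R) (A : set U) m n (f : U -> 'M[R]_(m, n)) :
  open A -> (forall i j, smooth_on A (fun x => f x i j)) -> smooth_on A f.
Proof.
move=> oA fA; apply: (smooth_coord (b := mx_coordinates m n) oA) => -[i j].
exact: fA.
Qed.

Lemma smooth_mx_entry (U : normedModType R) (A : set U) m n
    (f : U -> 'M[R]_(m, n)) i j :
  open A -> smooth_on A f -> smooth_on A (fun x => f x i j).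
Proof.
move=> oA; apply: (smooth_linear (l := @mx_entry m n i j) oA).
exact: coord_continuous.
Qed.

Lemma smooth_fst (U V W : normedModType R) (A : set U) (f : U -> (V * W)%type) :
  open A -> smooth_on A f -> smooth_on A (fun x => (f x).1).
Proof.
by move=> oA; apply: (smooth_linear (l := fst) oA) => x; exact: cvg_fst.
Qed.

Lemma smooth_snd (U V W : normedModType R) (A : set U) (f : U -> (V * W)%type) :
  open A -> smooth_on A f -> smooth_on A (fun x => (f x).2).
Proof.
by move=> oA; apply: (smooth_linear (l := snd) oA) => x; exact: cvg_snd.
Qed.

Lemma derive_fst (U V W : normedModType R) (f : U -> (V * W)%type) x v :
  differentiable f x -> 'D_v (fun y => (f y).1) x = ('D_v f x).1.
Proof. by apply: (derive_linear (l := fst)) => z; exact: cvg_fst. Qed.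

Lemma derive_snd (U V W : normedModType R) (f : U -> (V * W)%type) x v :
  differentiable f x -> 'D_v (fun y => (f y).2) x = ('D_v f x).2.
Proof. by apply: (derive_linear (l := snd)) => z; exact: cvg_snd. Qed.

Definition jmodel_coordinates m n : coordinates (jmodel R m n) :=
  prod_coordinates (prod_coordinates (mx_coordinates 1 m) (mx_coordinates 1 n))
    (mx_coordinates m n).

End ModelCoordinates.

(** * Changes of chart of the dual jet bundle *)

Section JetTransition.
Variables (R : realType) (m n : nat) (T : manifold R m) (M : manifold R n).
Variable E : dual_jet_bundle T M.

Local Notation J := (mindex T * mindex M)%type.
Local Notation V := (jmodel R m n).
Local Notation ch := (@jchart R m n T M E).
Local Notation dom g := (cdom (ch g)).
Local Notation img g U := (ch g @` (U `&` dom g)).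
Local Notation bV := (jmodel_coordinates R m n).

Implicit Types (g : J) (u : jspace E).

Lemma jdomE g u : dom g u <->
  cdom (mchart g.1) (jproj u).1 /\ cdom (mchart g.2) (jproj u).2.
Proof. by rewrite jchart_dom. Qed.

Lemma jbase_t g u : dom g u -> (ch g u).1.1 = mchart g.1 (jproj u).1.
Proof. by move=> gu; rewrite jchart_base. Qed.

Lemma jbase_x g u : dom g u -> (ch g u).1.2 = mchart g.2 (jproj u).2.
Proof. by move=> gu; rewrite jchart_base. Qed.

(** Jacobians of the changes of coordinates of the base, at the projection. *)
Definition dt g g' u (a' a : 'I_m) : R :=
  partial (mchart g.1) (mchart g'.1) (jproj u).1 a' a.
Definition dx g g' u (i' i : 'I_n) : R :=
  partial (mchart g.2) (mchart g'.2) (jproj u).2 i' i.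

Section TwoCharts.
Variables g g' : J.

Let A := ch g @` (dom g `&` dom g').
Let trT := transition (mchart g.1) (mchart g'.1).
Let trM := transition (mchart g.2) (mchart g'.2).
Let tr := transition (ch g) (ch g').

Lemma open_overlap : open A.
Proof. by rewrite /A setIC; apply: open_img; exact: cdom_open. Qed.

Let oA := open_overlap.

Lemma tr_base_t y : A y -> (tr y).1.1 = trT y.1.1.
Proof.
move=> [u [gu g'u] <-]; rewrite /tr transitionE // !jbase_t // /trT transitionE //.
by have [] := (jdomE g u).1 gu.
Qed.

Lemma tr_base_x y : A y -> (tr y).1.2 = trM y.1.2.
Proof.
move=> [u [gu g'u] <-]; rewrite /tr transitionE // !jbase_x // /trM transitionE //.
by have [] := (jdomE g u).1 gu.
Qed.

Lemma overlap_t y : A y ->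
  (mchart g.1 @` (cdom (mchart g.1) `&` cdom (mchart g'.1))) y.1.1.
Proof.
move=> [u [gu g'u] <-]; rewrite jbase_t //; exists (jproj u).1 => //.
by split; [have [] := (jdomE g u).1 gu|have [] := (jdomE g' u).1 g'u].
Qed.

Lemma overlap_x y : A y ->
  (mchart g.2 @` (cdom (mchart g.2) `&` cdom (mchart g'.2))) y.1.2.
Proof.
move=> [u [gu g'u] <-]; rewrite jbase_x //; exists (jproj u).2 => //.
by split; [have [] := (jdomE g u).1 gu|have [] := (jdomE g' u).1 g'u].
Qed.

Lemma smooth_y : smooth_on A (fun y : V => y).
Proof. exact: (smooth_id bV oA). Qed.

Lemma smooth_trT : smooth_on A (fun y => trT y.1.1).
Proof.
apply: (smooth_comp (mx_coordinates R 1 m) oA overlap_t _ (mcompat g.1 g'.1)).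
exact/(smooth_fst oA)/(smooth_fst oA)/smooth_y.
Qed.

Lemma smooth_trM : smooth_on A (fun y => trM y.1.2).
Proof.
apply: (smooth_comp (mx_coordinates R 1 n) oA overlap_x _ (mcompat g.2 g'.2)).
exact/(smooth_snd oA)/(smooth_fst oA)/smooth_y.
Qed.

Lemma smooth_dt a b : smooth_on A (fun y => dt g g' (cinv (ch g) y) a b).
Proof.
have s1 : smooth_on A (fun y => ('D_(delta_mx 0 b) trT y.1.1) 0 a).
  apply: (smooth_mx_entry _ _ oA).
  apply: (smooth_comp (h := 'D_(delta_mx 0 b) trT) (mx_coordinates R 1 m) oA overlap_t).
    exact/(smooth_fst oA)/(smooth_fst oA)/smooth_y.
  exact: (smooth_derive _ (mcompat g.1 g'.1)).
apply: (smooth_congr oA _ s1) => y; rewrite inE => -[u [gu g'u] <-].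
by rewrite (jbase_t gu) (cfunK gu).
Qed.

Lemma smooth_dx_inv i j : smooth_on A (fun y => dx g' g (cinv (ch g) y) j i).
Proof.
have s1 : smooth_on A (fun y =>
    ('D_(delta_mx 0 i) (transition (mchart g'.2) (mchart g.2)) (trM y.1.2)) 0 j).
  apply: (smooth_mx_entry _ _ oA).
  apply: (smooth_comp (h := 'D_(delta_mx 0 i) (transition (mchart g'.2) (mchart g.2)))
    (mx_coordinates R 1 n) oA _ smooth_trM (smooth_derive _ (mcompat g'.2 g.2))).
  move=> y /overlap_x [x [gx g'x] <-]; rewrite /trM transitionE //.
  by exists x.
apply: (smooth_congr oA _ s1) => y; rewrite inE => -[u [gu g'u] <-].
have [_ gx] := (jdomE g u).1 gu.
by rewrite (jbase_x gu) (cfunK gu) /trM (transitionE _ gx).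
Qed.

(** The base components are the transition maps of the two manifolds, and the
    fibre components are polynomial in the fibre coordinates and the first
    derivatives of those maps. *)
Lemma jet_transition_smooth : smooth_on A tr.
Proof.
have sf : smooth_on A (fun y => \matrix_(a, i) \sum_(j < n) \sum_(b < m)
    (dx g' g (cinv (ch g) y) j i * dt g g' (cinv (ch g) y) a b) *: y.2 b j).
  apply: (smooth_mx oA) => a i.
  have sm : smooth_on A (fun y => \sum_(j < n) \sum_(b < m)
    (dx g' g (cinv (ch g) y) j i * dt g g' (cinv (ch g) y) a b) *: y.2 b j).
    do 2![apply: smooth_sum => // ?]; apply: smooth_scale => //.
      apply: (smooth_scale oA); first exact: smooth_dx_inv.
      exact: smooth_dt.
    apply: (smooth_mx_entry _ _ oA); apply: (smooth_snd oA); exact: smooth_y.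
  by apply: (smooth_congr oA _ sm) => y _; rewrite mxE.
have sb := smooth_pair (prod_coordinates (mx_coordinates R 1 m) (mx_coordinates R 1 n))
  (mx_coordinates R m n) oA
  (smooth_pair (mx_coordinates R 1 m) (mx_coordinates R 1 n) oA smooth_trT smooth_trM) sf.
apply: (smooth_congr oA _ sb) => y; rewrite inE => Ay.
rewrite -(tr_base_t Ay) -(tr_base_x Ay) -surjective_pairing.
rewrite [RHS]surjective_pairing; congr (_, _).
case: Ay => u [gu g'u] <-; rewrite /tr transitionE //; apply/matrixP => a i.
by rewrite mxE cfunK // (jchart_fibre gu g'u).
Qed.

Hypotheses (u : jspace E) (gu : dom g u) (g'u : dom g' u).

Let Au : A (ch g u). Proof. by exists u. Qed.
Let dtr : differentiable tr (ch g u).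
Proof. exact: (smooth_diff jet_transition_smooth Au). Qed.

Lemma row_derive k l (F : 'rV[R]_k -> 'rV[R]_l) x w j : differentiable F x ->
  ('D_w F x) 0 j = \sum_i w 0 i * ('D_(delta_mx 0 i) F x) 0 j.
Proof.
move=> dF; rewrite {1}(row_sum_delta w) derive_dir_sum // summxE.
by apply: eq_bigr => i _; rewrite mxE.
Qed.

Lemma push_t v a' : (pushv ch g g' u v).1.1 0 a' = \sum_a v.1.1 0 a * dt g g' u a' a.
Proof.
have [gt _] := (jdomE g u).1 gu.
have dT : differentiable trT (ch g u).1.1.
  exact: (smooth_diff (mcompat g.1 g'.1) (overlap_t Au)).
have d1 : differentiable (fun y : V => y.1.1) (ch g u).
  exact: (smooth_diff (smooth_fst oA (smooth_fst oA smooth_y)) Au).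
have d2 : differentiable (fun y => (tr y).1) (ch g u).
  exact: (smooth_diff (smooth_fst oA jet_transition_smooth) Au).
have -> : (pushv ch g g' u v).1.1 = 'D_(v.1.1) trT (ch g u).1.1.
  rewrite /pushv -(derive_fst v dtr) -(derive_fst v d2).
  rewrite (derive_congr v oA Au (g := fun y => trT y.1.1)); last first.
    by move=> y; rewrite inE; exact: tr_base_t.
  rewrite (derive_comp v d1 dT); congr ('D_ _ _ _).
  have dy : differentiable (fun y : V => y) (ch g u) := smooth_diff smooth_y Au.
  have dy1 : differentiable (fun y : V => y.1) (ch g u).
    exact: (smooth_diff (smooth_fst oA smooth_y) Au).
  by rewrite (derive_fst v dy1) (derive_fst v dy) derive_id.
by rewrite (row_derive v.1.1 a' dT) (jbase_t gu).
Qed.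

Lemma push_x v i' : (pushv ch g g' u v).1.2 0 i' = \sum_i v.1.2 0 i * dx g g' u i' i.
Proof.
have [_ gx] := (jdomE g u).1 gu.
have dM : differentiable trM (ch g u).1.2.
  exact: (smooth_diff (mcompat g.2 g'.2) (overlap_x Au)).
have d1 : differentiable (fun y : V => y.1.2) (ch g u).
  exact: (smooth_diff (smooth_snd oA (smooth_fst oA smooth_y)) Au).
have d2 : differentiable (fun y => (tr y).1) (ch g u).
  exact: (smooth_diff (smooth_fst oA jet_transition_smooth) Au).
have -> : (pushv ch g g' u v).1.2 = 'D_(v.1.2) trM (ch g u).1.2.
  rewrite /pushv -(derive_fst v dtr) -(derive_snd v d2).
  rewrite (derive_congr v oA Au (g := fun y => trM y.1.2)); last first.
    by move=> y; rewrite inE; exact: tr_base_x.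
  rewrite (derive_comp v d1 dM); congr ('D_ _ _ _).
  have dy : differentiable (fun y : V => y) (ch g u) := smooth_diff smooth_y Au.
  have dy1 : differentiable (fun y : V => y.1) (ch g u).
    exact: (smooth_diff (smooth_fst oA smooth_y) Au).
  by rewrite (derive_snd v dy1) (derive_fst v dy) derive_id.
by rewrite (row_derive v.1.2 i' dM) (jbase_x gu).
Qed.

(** In a fibre the change of chart is linear, so it equals its differential. *)
Lemma push_p (P : 'M[R]_(m, n)) : pushv ch g g' u ((0, 0, P) : V) =
  ((0, 0, \matrix_(a, i) \sum_(j < n) \sum_(b < m)
    dx g' g u j i * dt g g' u a b * P b j) : V).
Proof.
apply: derive_along_line.
pose line (h : R) : V := h *: ((0, 0, P) : V) + ch g u.
have cl : {for 0, continuous line}.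
  apply: cvgD; last exact: cvg_cst.
  by apply: cvgZ; [exact: cvg_id|exact: cvg_cst].
have nA : nbhs (line 0) A.
  by rewrite /line scale0r add0r; apply: open_nbhs_nbhs.
have nl : nbhs (0 : R) (line @^-1` A) := cl _ nA.
apply: filterS nl => h [w [gw g'w] wE].
have [gt gx] := (jdomE g u).1 gu; have [gt' gx'] := (jdomE g w).1 gw.
have lineE : line h = ((ch g u).1, h *: P + (ch g u).2).
  by rewrite /line; case: (ch g u) => -[t x] p; congr (_, _, _);
     rewrite /= scaler0 add0r.
have [w1 w2] : (ch g w).1 = (ch g u).1 /\ (ch g w).2 = h *: P + (ch g u).2.
  by rewrite wE lineE.
have wu : jproj w = jproj u.
  rewrite [jproj w]surjective_pairing [jproj u]surjective_pairing.
  rewrite -(cfunK gt) -(cfunK gx) -(cfunK gt') -(cfunK gx').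
  by rewrite -!jbase_t // -!jbase_x // w1.
rewrite -/(line h) -wE !(transitionE _ gw, transitionE _ gu).
rewrite [LHS]surjective_pairing [ch g' u]surjective_pairing.
have -> : (ch g' w).1 = (ch g' u).1 by rewrite !jchart_base // wu.
case: (ch g' u).1 => t x; congr (_, _, _).
- by rewrite /= scaler0 addr0.
- by rewrite /= scaler0 addr0.
apply/matrixP => a i; rewrite !mxE (jchart_fibre gw g'w) (jchart_fibre gu g'u) wu w2.
rewrite mulr_sumr -big_split; apply: eq_bigr => j _ /=.
rewrite mulr_sumr -big_split; apply: eq_bigr => b _ /=.
by rewrite !mxE mulrDr addrC; congr (_ + _); rewrite mulrCA.
Qed.

End TwoCharts.

End JetTransition.

(** * The adapted basis *)

Section AdaptedFrame.
Variables (R : realType) (m n : nat) (T : manifold R m) (M : manifold R n).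
Variables (E : dual_jet_bundle T M) (N : nonlinear_connection E).

Local Notation J := (mindex T * mindex M)%type.
Local Notation V := (jmodel R m n).
Local Notation ch := (@jchart R m n T M E).
Local Notation dom g := (cdom (ch g)).
Local Notation img g U := (ch g @` (U `&` dom g)).
Local Notation bV := (jmodel_coordinates R m n).
Local Notation sT := (jet_transition_smooth E).
Local Notation SF := (smooth_fun ch).
Local Notation SV := (smooth_vfield ch).
Local Notation "X ~[ U ] Y" := (vfield_eq ch U X Y) (at level 70).

Implicit Types (g : J) (u : jspace E) (v : V).

(* The three families of the adapted basis are gathered under one index type. *)
Local Notation K := ('I_m + 'I_n + 'I_m * 'I_n)%type.

Definition frame_vec g (k : K) u : V :=
  match k with
  | inl (inl a) => delta_t_comp N g a u
  | inl (inr i) => delta_x_comp N g i u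
  | inr q => d_p_comp q u
  end.

Definition adapted g (k : K) : jvfield E := local_vfield ch g (frame_vec g k).

(** The vertical coordinates are corrected by the coefficients of the
    nonlinear connection, as the horizontal basis vectors have a fibre part. *)
Definition coord g u (k : K) v : R :=
  match k with
  | inl (inl a) => v.1.1 0 a
  | inl (inr i) => v.1.2 0 i
  | inr q => (v.2 + \sum_a v.1.1 0 a *: nl_N1 N g u a
                  + \sum_i v.1.2 0 i *: nl_N2 N g u i) q.1 q.2
  end.

Lemma coord_is_linear g u k : linear (coord g u k).
Proof.
move=> c v w; have [E1 [E2 E3]] : (c *: v + w).1.1 = c *: v.1.1 + w.1.1 /\
  (c *: v + w).1.2 = c *: v.1.2 + w.1.2 /\ (c *: v + w).2 = c *: v.2 + w.2 by [].
case: k => [[a|i]|q]; rewrite /coord ?E1 ?E2 ?E3; [by rewrite !mxE| by rewrite !mxE|].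
rewrite !mxE !summxE.
have sumE (l : nat) (x y : 'rV[R]_l) (F : 'I_l -> 'M[R]_(m, n)) :
    \sum_a (((c *: x + y) 0 a *: F a) q.1 q.2) =
    c * (\sum_a (x 0 a *: F a) q.1 q.2) + \sum_a (y 0 a *: F a) q.1 q.2.
  rewrite mulr_sumr -big_split; apply: eq_bigr => a _ /=.
  by rewrite !mxE mulrDl mulrA.
by rewrite !sumE !scalerDr (addrACA (c * v.2 q.1 q.2)) (addrACA (c * v.2 q.1 q.2 + _)).
Qed.
HB.instance Definition _ g u k := GRing.isLinear.Build R V R _
  (coord g u k) (coord_is_linear g u k).

Lemma frame_combination g u (f : K -> R) : \sum_k f k *: frame_vec g k u =
  ((\row_a f (inl (inl a)), \row_i f (inl (inr i)),
    \matrix_(b, j) f (inr (b, j)) - \sum_a f (inl (inl a)) *: nl_N1 N g u a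
      - \sum_i f (inl (inr i)) *: nl_N2 N g u i) : V).
Proof.
pose S := \sum_k f k *: frame_vec g k u.
have S1 : S.1.1 = \row_a f (inl (inl a)).
  rewrite /S (linear_sum fst) (linear_sum fst) !big_sumType /=.
  rewrite [X in _ + X + _]big1 => [|i _]; last by rewrite scaler0.
  rewrite [X in _ + X]big1 => [|q _]; last by rewrite scaler0.
  rewrite !addr0 [RHS]row_sum_delta; apply: eq_bigr => a _.
  by rewrite mxE.
have S2 : S.1.2 = \row_i f (inl (inr i)).
  rewrite /S (linear_sum fst) (linear_sum snd) !big_sumType /=.
  rewrite [X in X + _ + _]big1 => [|i _]; last by rewrite scaler0.
  rewrite [X in _ + X]big1 => [|q _]; last by rewrite scaler0.
  rewrite addr0 add0r [RHS]row_sum_delta; apply: eq_bigr => a _.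
  by rewrite mxE.
have S3 : S.2 = \matrix_(b, j) f (inr (b, j)) -
    \sum_a f (inl (inl a)) *: nl_N1 N g u a -
    \sum_i f (inl (inr i)) *: nl_N2 N g u i.
  rewrite /S (linear_sum snd) !big_sumType /= addrC addrA; congr (_ + _ + _).
  - rewrite [RHS](matrix_sum_delta) pair_big; apply: eq_bigr => -[b j] _ /=.
    by rewrite mxE.
  - by rewrite -sumrN; apply: eq_bigr => a _; rewrite scalerN.
  - by rewrite -sumrN; apply: eq_bigr => a _; rewrite scalerN.
by rewrite -/S -S1 -S2 -S3 -!surjective_pairing.
Qed.

Lemma coord_decomp g u v : v = \sum_k coord g u k v *: frame_vec g k u.
Proof.
rewrite frame_combination /=; case: v => -[t x] p /=; congr (_, _, _).
- by apply/rowP => a; rewrite mxE.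
- by apply/rowP => i; rewrite mxE.
set A := \sum_a _; set B := \sum_i _.
suff -> : \matrix_(b, j) (p + A + B) b j = p + A + B.
  by rewrite addrAC addrK addrK.
by apply/matrixP => b j; rewrite mxE.
Qed.

Lemma coord_combination g u (f : K -> R) k :
  coord g u k (\sum_k f k *: frame_vec g k u) = f k.
Proof.
rewrite frame_combination; case: k => [[a|i]|[b j]] /=; rewrite ?mxE //.
rewrite !summxE.
under [X in _ + X + _]eq_bigr do rewrite !mxE.
under [X in _ + X]eq_bigr do rewrite !mxE.
under [X in _ - X - _ + _ + _]eq_bigr do rewrite mxE.
under [X in _ - _ - X + _ + _]eq_bigr do rewrite mxE.
by rewrite addrAC subrK subrK.
Qed.

Lemma smooth_frame_vec g k :
  smooth_on (img g (dom g)) (fun y => frame_vec g k (cinv (ch g) y)).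
Proof.
have oA : open (img g (dom g)) by apply/open_img/cdom_open.
have sN (F : jspace E -> 'M[R]_(m, n)) : (forall b j, SF (dom g) (fun u => F u b j)) ->
    smooth_on (img g (dom g)) (fun y => - F (cinv (ch g) y)).
  by move=> sF; apply: (smoothN oA); apply: (smooth_mx oA) => b j; exact: sF.
have sp := smooth_pair (prod_coordinates (mx_coordinates R 1 m) (mx_coordinates R 1 n))
  (mx_coordinates R m n) oA.
case: k => [[a|i]|q] /=.
- apply: (sp _ _ (smooth_cst _ (delta_mx 0 a, 0)) (sN (nl_N1 N g ^~ a) _)) => b j.
  exact: nl_N1_smooth.
- apply: (sp _ _ (smooth_cst _ (0, delta_mx 0 i)) (sN (nl_N2 N g ^~ i) _)) => b j.
  exact: nl_N2_smooth.
exact: smooth_cst.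
Qed.

Lemma smooth_adapted g k : SV (dom g) (adapted g k).
Proof. exact: (smooth_local_vfield bV sT (smooth_frame_vec g k)). Qed.

Lemma adapted_id g k u : dom g u -> adapted g k g u = frame_vec g k u.
Proof. by move=> gu; rewrite /adapted /local_vfield push_id. Qed.

Lemma smooth_coord_vfield U g X k : open U -> U `<=` dom g -> SV U X ->
  SF U (fun u => coord g u k (X g u)).
Proof.
move=> oU Ug [_ sX]; apply: (smooth_fun_chart bV sT oU Ug).
have oA : open (img g U) by exact: open_img.
have s1 := smooth_fst oA (sX g).
have st a : smooth_on (img g U) (fun y => (X g (cinv (ch g) y)).1.1 0 a).
  exact/(smooth_mx_entry _ _ oA)/(smooth_fst oA).
have sx i : smooth_on (img g U) (fun y => (X g (cinv (ch g) y)).1.2 0 i).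
  exact/(smooth_mx_entry _ _ oA)/(smooth_snd oA).
have sN (F : jspace E -> 'M[R]_(m, n)) : (forall b j, SF (dom g) (fun u => F u b j)) ->
    smooth_on (img g U) (fun y => F (cinv (ch g) y)).
  move=> sF; apply: (smooth_mx oA) => b j.
  exact: (smooth_fun_sub Ug (sF b j) g).
case: k => [[a|i]|[b j]]; [exact: st|exact: sx|].
have s2 := smooth_snd oA (sX g).
have s3 : smooth_on (img g U) (fun y => \sum_a
    (X g (cinv (ch g) y)).1.1 0 a *: nl_N1 N g (cinv (ch g) y) a).
  apply: smooth_sum => // a; apply: smooth_scale => //.
  by apply: (sN (nl_N1 N g ^~ a)) => b' j'; exact: nl_N1_smooth.
have s4 : smooth_on (img g U) (fun y => \sum_i
    (X g (cinv (ch g) y)).1.2 0 i *: nl_N2 N g (cinv (ch g) y) i).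
  apply: smooth_sum => // i; apply: smooth_scale => //.
  by apply: (sN (nl_N2 N g ^~ i)) => b' j'; exact: nl_N2_smooth.
exact: (smooth_mx_entry b j oA (smoothD oA (smoothD oA s2 s3) s4)).
Qed.

Lemma adapted_decomp U g X : U `<=` dom g -> SV U X ->
  X ~[U] combination (fun k u => coord g u k (X g u)) (adapted g).
Proof.
move=> Ug [vX _] g' u Uu g'u; have gu := Ug u Uu.
rewrite (vX g g') // {1}(coord_decomp g u (X g u)).
exact: (push_sum sT _ _ gu g'u).
Qed.

(** * The three distributions *)

Definition family (k : K) : frame :=
  match k with inl (inl _) => Ft | inl (inr _) => Fx | inr _ => Fp end.

Definition family_dist (z : frame) : Defs.distribution (jspace E) V J :=
  match z with Ft => hor_t N | Fx => hor_x N | Fp => @vertical R m n T M E end.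

Lemma verticalE g u v : dom g u -> @vertical R m n T M E g u v <-> v.1 = 0.
Proof.
move=> gu.
have oA : open (img g (dom g)) by apply/open_img/cdom_open.
have Au : img g (dom g) (ch g u) by exists u.
rewrite /vertical /=.
rewrite (derive_congr v oA Au (g := fun y : V => y.1)).
  have dy : differentiable (fun y : V => y) (ch g u).
    exact: (smooth_diff (smooth_id bV oA) Au).
  by rewrite (derive_fst v dy) derive_id.
by move=> y; rewrite inE => -[w [_ gw] <-]; rewrite cfunK // jchart_base.
Qed.

(** Linear equations for the three distributions: they pass to the linear
    combinations that make up the curvature. *)
Lemma family_distE z g u v : dom g u ->
  family_dist z g u v <-> forall k, family k <> z -> coord g u k v = 0.
Proof.
move=> gu; case: z => /=.
- split=> [[s ->] k kz|v0].
    have -> : \sum_a s a *: delta_t_comp N g a u = \sum_k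
        (if k is inl (inl a) then s a else 0) *: frame_vec g k u.
      rewrite !big_sumType /= [X in _ + X + _]big1 => [|i _]; last by rewrite scale0r.
      by rewrite [X in _ + X]big1 => [|q _]; rewrite ?scale0r // !addr0.
    by rewrite coord_combination; move: k kz => [[a|i]|q].
  have vz k : family k <> Ft -> coord g u k v *: frame_vec g k u = 0.
    by move=> /v0 ->; rewrite scale0r.
  exists (fun a => coord g u (inl (inl a)) v).
  rewrite {1}(coord_decomp g u v) !big_sumType /=.
  rewrite [X in _ + X + _]big1 => [|i _]; last by apply: (vz (inl (inr i))).
  rewrite [X in _ + X]big1 => [|q _]; last by apply: (vz (inr q)).
  by rewrite !addr0.
- split=> [[s ->] k kz|v0].
    have -> : \sum_i s i *: delta_x_comp N g i u = \sum_k
        (if k is inl (inr i) then s i else 0) *: frame_vec g k u.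
      rewrite !big_sumType /= [X in X + _ + _]big1 => [|i _]; last by rewrite scale0r.
      by rewrite [X in _ + X]big1 => [|q _]; rewrite ?scale0r // addr0 add0r.
    by rewrite coord_combination; move: k kz => [[a|i]|q].
  have vz k : family k <> Fx -> coord g u k v *: frame_vec g k u = 0.
    by move=> /v0 ->; rewrite scale0r.
  exists (fun i => coord g u (inl (inr i)) v).
  rewrite {1}(coord_decomp g u v) !big_sumType /=.
  rewrite [X in X + _ + _]big1 => [|a _]; last by apply: (vz (inl (inl a))).
  rewrite [X in _ + X]big1 => [|q _]; last by apply: (vz (inr q)).
  by rewrite addr0 add0r.
split=> [/(verticalE v gu) v1 [[a|i]|q] kz|v0].
- by rewrite /= v1 mxE.
- by rewrite /= v1 mxE.
- by case: kz.
apply/(verticalE v gu); rewrite [v.1]surjective_pairing; congr (_, _).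
  by apply/rowP => a; have /= -> := v0 (inl (inl a)); rewrite ?mxE.
by apply/rowP => i; have /= -> := v0 (inl (inr i)); rewrite ?mxE.
Qed.


(** * Change of adapted basis *)

(** The row k lists the coordinates, in the basis of g', of the vector k of the
    basis of g ([coord_adapted]).  The entries are the factors of the d-tensor
    law for a lower index; those for an upper index are read off with the two
    charts exchanged. *)
Definition jac g g' u (k k' : K) : R :=
  match k, k' with
  | inl (inl a), inl (inl a') => dt g g' u a' a
  | inl (inr i), inl (inr i') => dx g g' u i' i
  | inr q, inr q' => dx g' g u q.2 q'.2 * dt g g' u q'.1 q.1
  | _, _ => 0
  end.

Lemma hor_coord_p g u v q : dom g u -> nl_hor N g u v -> coord g u (inr q) v = 0.
Proof.
move=> gu /(nl_span N v gu) [s [y ->]].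
have -> : \sum_(a < m) s a *: ((delta_mx 0 a, 0, - nl_N1 N g u a) : V)
    + \sum_(i < n) y i *: ((0, delta_mx 0 i, - nl_N2 N g u i) : V) =
  \sum_k (match k with inl (inl a) => s a | inl (inr i) => y i | _ => 0 end)
    *: frame_vec g k u.
  rewrite !big_sumType /= [X in _ = _ + X]big1 ?addr0 // => r _.
  by rewrite scale0r.
by rewrite coord_combination.
Qed.

Lemma adapted_hor g u (k : 'I_m + 'I_n) : dom g u -> nl_hor N g u (frame_vec g (inl k) u).
Proof.
move=> gu; apply/(nl_span N _ gu); case: k => k /=.
  exists (fun a => (a == k)%:R), (fun=> 0).
  rewrite [X in _ + X]big1 ?addr0 => [|i _]; last by rewrite scale0r.
  rewrite (bigD1 k) //= eqxx scale1r big1 ?addr0 // => a /negbTE ->.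
  by rewrite scale0r.
exists (fun=> 0), (fun i => (i == k)%:R).
rewrite [X in X + _]big1 ?add0r => [|i _]; last by rewrite scale0r.
rewrite (bigD1 k) //= eqxx scale1r big1 ?addr0 // => a /negbTE ->.
by rewrite scale0r.
Qed.

Lemma sum_delta_row l (F : 'I_l -> R) (a : 'I_l) :
  \sum_i (delta_mx 0 a : 'rV[R]_l) 0 i * F i = F a.
Proof.
rewrite (bigD1 a) //= mxE !eqxx mul1r big1 ?addr0 // => i /negbTE ia.
by rewrite mxE eqxx ia mul0r.
Qed.

Lemma sum_zero_row l (F : 'I_l -> R) : \sum_i (0 : 'rV[R]_l) 0 i * F i = 0.
Proof. by rewrite big1 // => i _; rewrite mxE mul0r. Qed.

Lemma sum_delta_mx k l (F : 'I_l -> 'I_k -> R) (q : 'I_k * 'I_l) :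
  \sum_j \sum_i F j i * (delta_mx q.1 q.2 : 'M[R]_(k, l)) i j = F q.2 q.1.
Proof.
rewrite (bigD1 q.2) //= (bigD1 q.1) //= mxE !eqxx mulr1.
rewrite big1 => [|i /negbTE iq]; last by rewrite mxE iq mulr0.
rewrite big1 ?addr0 // => j /negbTE jq; rewrite big1 // => i _.
by rewrite mxE jq andbF mulr0.
Qed.

(** A horizontal vector has no vertical coordinate in either chart, since the
    horizontal distribution is the same in both; its other coordinates are
    those of its projection to the base. *)
Lemma coord_adapted g g' u k k' : dom g u -> dom g' u ->
  coord g' u k' (adapted g k g' u) = jac g g' u k k'.
Proof.
move=> gu g'u; rewrite /adapted /local_vfield.
case: k => [k|q].
  have hv := nl_invariant gu g'u (adapted_hor k gu).
  case: k' => [[a'|i']|q']; last by rewrite (hor_coord_p q' g'u hv); case: k {hv}.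
    rewrite /= (push_t gu g'u); case: k {hv} => [a|i] /=.
      exact: sum_delta_row.
    exact: sum_zero_row.
  rewrite /= (push_x gu g'u); case: k {hv} => [a|i] /=.
    exact: sum_zero_row.
  exact: sum_delta_row.
rewrite /frame_vec /d_p_comp (push_p gu g'u).
case: k' => [[a'|i']|[a i]]; rewrite /coord /= ?mxE //.
rewrite !summxE [X in _ + X + _]big1 => [|b _]; last by rewrite !mxE mul0r.
rewrite [X in _ + X]big1 => [|b _]; last by rewrite !mxE mul0r.
rewrite !addr0; exact: (sum_delta_mx (fun j b => dx g' g u j i * dt g g' u a b)).
Qed.

Lemma adapted_section g k :
  section_of ch (family_dist (family k)) (dom g) (adapted g k).
Proof.
split=> [|g' u gu g'u]; first exact: smooth_adapted.
apply/(family_distE _ _ g'u) => k' kk'; rewrite coord_adapted //.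
by case: k kk' => [[a|i]|q]; case: k' => [[a'|i']|q'].
Qed.

(** * The d-tensors of curvature *)

Section Curvature.
Variables (D : jvfield E -> jvfield E -> jvfield E).
Hypothesis hD : N_linear_connection N D.
Local Notation Rm := (curvature ch D).

Let connD : linear_connection ch D. Proof. by case: hD. Qed.

Lemma family_preserved z : preserves ch D (family_dist z).
Proof. by case: hD; case: z. Qed.

Lemma curvature_section U X Y Z z : open U -> SV U X -> SV U Y ->
  section_of ch (family_dist z) U Z -> section_of ch (family_dist z) U (Rm X Y Z).
Proof.
move=> oU sX sY sZ; have [vZ _] := sZ.
split=> [|g u Uu gu]; first exact: (smooth_curvature bV sT connD oU sX sY vZ).
have P A B := @family_preserved z U A B oU.
have [_ s1] := P _ _ sX (P _ _ sY sZ).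
have [_ s2] := P _ _ sY (P _ _ sX sZ).
have [_ s3] := P _ _ (smooth_bracket bV sT oU sX sY) sZ.
apply/(family_distE _ _ gu) => k kz.
have c0 v : family_dist z g u v -> coord g u k v = 0.
  by move=> /(family_distE _ _ gu) /(_ k kz).
rewrite /curvature /vsub /vadd /vopp !linearB /=.
by rewrite (c0 _ (s1 g u Uu gu)) (c0 _ (s2 g u Uu gu)) (c0 _ (s3 g u Uu gu)) !subr0.
Qed.

Definition curv_field g k1 k2 k3 : jvfield E :=
  Rm (adapted g k1) (adapted g k2) (adapted g k3).

Definition curv_coef g u k1 k2 k3 k0 : R :=
  coord g u k0 (curv_field g k1 k2 k3 g u).

Lemma curv_field_section g k1 k2 k3 :
  section_of ch (family_dist (family k3)) (dom g) (curv_field g k1 k2 k3).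
Proof.
apply: curvature_section; [exact: cdom_open|exact: smooth_adapted..|].
exact: adapted_section.
Qed.

Lemma smooth_curv_coef g k1 k2 k3 k0 :
  SF (dom g) (fun u => curv_coef g u k1 k2 k3 k0).
Proof.
have [sW _] := curv_field_section g k1 k2 k3.
exact: (smooth_coord_vfield k0 (cdom_open (ch g)) (fun _ x => x) sW).
Qed.

(** Interchanges the order in which the frame expansions are made with the
    order of the indices of a d-tensor. *)
Lemma nested_sums (L : finType) (p q r s : L -> R) (c : L -> L -> L -> L -> R) :
  \sum_j1 \sum_j2 \sum_j3 p j1 * (q j2 * (r j3 * \sum_j0 c j1 j2 j3 j0 * s j0)) =
  \sum_j0 s j0 * (\sum_j3 r j3 * (\sum_j2 q j2 * (\sum_j1 p j1 * c j1 j2 j3 j0))).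
Proof.
transitivity (\sum_j1 \sum_j2 \sum_j3 \sum_j0
    s j0 * (r j3 * (q j2 * (p j1 * c j1 j2 j3 j0)))).
  do 3![apply: eq_bigr => ? _]; rewrite !mulr_sumr; apply: eq_bigr => j _.
  rewrite [X in p _ * (q _ * (r _ * X))]mulrC.
  rewrite !(mulrCA _ (s j)) (mulrCA (p _) (q _)) (mulrCA (p _) (r _)).
  by rewrite (mulrCA (q _) (r _)).
under eq_bigr => j1 _ do under eq_bigr => j2 _ do rewrite exchange_big.
under eq_bigr => j1 _ do rewrite exchange_big.
rewrite exchange_big; apply: eq_bigr => j0 _.
under eq_bigr => j1 _ do rewrite exchange_big.
rewrite exchange_big mulr_sumr; apply: eq_bigr => j3 _.
rewrite exchange_big !mulr_sumr; apply: eq_bigr => j2 _.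
by rewrite !mulr_sumr.
Qed.

(** The three arguments are expanded in the frame of g', which brings the
    factors of the lower indices; the resulting values of the curvature are
    then read in the frame of g, which brings the factor of the upper one. *)
Lemma curv_coef_chart g g' u k1 k2 k3 k0 : dom g u -> dom g' u ->
  curv_coef g u k1 k2 k3 k0 = \sum_j0 jac g' g u j0 k0 *
    (\sum_j3 jac g g' u k3 j3 * (\sum_j2 jac g g' u k2 j2 *
      (\sum_j1 jac g g' u k1 j1 * curv_coef g' u j1 j2 j3 j0))).
Proof.
move=> gu g'u; set U := dom g `&` dom g'.
have oU : open U by apply: openI; exact: cdom_open.
have Ug : U `<=` dom g by exact: subIsetl.
have Ug' : U `<=` dom g' by exact: subIsetr.
have sa k : SV U (adapted g k) := smooth_vfield_sub Ug (smooth_adapted g k).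
have sa' k : SV U (adapted g' k) := smooth_vfield_sub Ug' (smooth_adapted g' k).
have dec k := adapted_decomp Ug' (sa k).
have sc k k' := smooth_coord_vfield k' oU Ug' (sa k).
have Uu : U u by [].
have W := curvature_expand bV sT connD oU Ug' sa'
  (sc k1) (sc k2) (sc k3) (sa k1) (sa k2) (sa k3) (dec k1) (dec k2) (dec k3) Uu gu.
apply: (etrans (congr1 (coord g u k0) W)) => {W}.
rewrite -nested_sums linear_sum; apply: eq_bigr => j1 _.
rewrite linear_sum; apply: eq_bigr => j2 _.
rewrite linear_sum; apply: eq_bigr => j3 _.
rewrite !linearZ !(coord_adapted _ _ gu g'u) /=.
do 3!congr (_ * _).
have [sW _] := curv_field_section g' j1 j2 j3.
rewrite -/(curv_field g' j1 j2 j3) (adapted_decomp (fun _ x => x) sW g'u gu).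
rewrite linear_sum; apply: eq_bigr => j0 _.
by rewrite linearZ /= (coord_adapted _ _ g'u gu).
Qed.

Definition slot_frame (s : slot) : slot_idx m n s -> K :=
  match s return slot_idx m n s -> K with
  | ITup | ITlow => fun a => inl (inl a)
  | IXup | IXlow => fun i => inl (inr i)
  | IPup | IPlow => fun q => inr q
  end.

Definition lower (s : slot) : bool :=
  match s with ITlow | IXlow | IPlow => true | _ => false end.

Lemma sum_lower g g' u s (i : slot_idx m n s) (F : K -> R) : lower s ->
  \sum_j jac g g' u (slot_frame i) j * F j =
  \sum_j slot_factor g g' u i j * F (slot_frame j).
Proof.
case: s i => // i _; rewrite !big_sumType /=.
- rewrite [X in _ + X + _]big1 => [|j _]; last by rewrite mul0r.
  by rewrite [X in _ + X]big1 => [|j _]; rewrite ?mul0r // !addr0.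
- rewrite [X in X + _ + _]big1 => [|j _]; last by rewrite mul0r.
  by rewrite [X in _ + X]big1 => [|j _]; rewrite ?mul0r // addr0 add0r.
rewrite [X in X + _ + _]big1 => [|j _]; last by rewrite mul0r.
by rewrite [X in _ + X + _]big1 => [|j _]; rewrite ?mul0r // !add0r.
Qed.

Lemma sum_upper g g' u s (i : slot_idx m n s) (F : K -> R) : ~~ lower s ->
  \sum_j jac g' g u j (slot_frame i) * F j =
  \sum_j slot_factor g g' u i j * F (slot_frame j).
Proof.
case: s i => // i _; rewrite !big_sumType /=.
- rewrite [X in _ + X + _]big1 => [|j _]; last by rewrite mul0r.
  by rewrite [X in _ + X]big1 => [|j _]; rewrite ?mul0r // !addr0.
- rewrite [X in X + _ + _]big1 => [|j _]; last by rewrite mul0r.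
  by rewrite [X in _ + X]big1 => [|j _]; rewrite ?mul0r // addr0 add0r.
rewrite [X in X + _ + _]big1 => [|j _]; last by rewrite mul0r.
rewrite [X in _ + X + _]big1 => [|j _]; rewrite ?mul0r // !add0r.
by apply: eq_bigr => j _; rewrite [X in X * _]mulrC.
Qed.

(** The sign eps is -1 for the vertical family, whose defining equations carry
    a minus sign, and 1 for the two others. *)
Definition curv_comp (eps : R) (s0 s1 s2 s3 : slot) :
    components E [:: s0; s1; s2; s3] := fun g u I =>
  eps * curv_coef g u (slot_frame I.2.2.2.1) (slot_frame I.2.2.1)
                      (slot_frame I.2.1) (slot_frame I.1).

Lemma curv_comp_d_tensor eps s0 s1 s2 s3 :
  ~~ lower s0 -> lower s1 -> lower s2 -> lower s3 ->
  d_tensor (@curv_comp eps s0 s1 s2 s3).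
Proof.
move=> l0 l1 l2 l3; split=> [g I g'|g g' u [i0 [i1 [i2 [i3 []]]]] gu g'u].
  apply: smooth_scale; [exact/open_img/cdom_open|exact: smooth_cst|].
  exact: smooth_curv_coef.
rewrite /curv_comp /= (curv_coef_chart _ _ _ _ gu g'u) (sum_upper _ _ _ _ _ l0).
rewrite mulr_sumr; apply: eq_bigr => j0 _; rewrite mulrCA; congr (_ * _).
rewrite (sum_lower _ _ _ _ _ l1).
rewrite mulr_sumr; apply: eq_bigr => j1 _; rewrite mulrCA; congr (_ * _).
rewrite (sum_lower _ _ _ _ _ l2).
rewrite mulr_sumr; apply: eq_bigr => j2 _; rewrite mulrCA; congr (_ * _).
rewrite (sum_lower _ _ _ _ _ l3).
by rewrite mulr_sumr; apply: eq_bigr => j3 _; rewrite mulrCA.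
Qed.

Definition curv_block eps (s0 s1 : slot) (b : block) :
    components E ([:: s0; s1] ++ block_slots b) :=
  match b return components E ([:: s0; s1] ++ block_slots b) with
  | Btt => @curv_comp eps s0 s1 ITlow ITlow
  | Btx => @curv_comp eps s0 s1 ITlow IXlow
  | Btp => @curv_comp eps s0 s1 ITlow IPlow
  | Bxx => @curv_comp eps s0 s1 IXlow IXlow
  | Bxp => @curv_comp eps s0 s1 IXlow IPlow
  | Bpp => @curv_comp eps s0 s1 IPlow IPlow
  end.

Definition curv_tensors : curvature_components E := fun z =>
  match z return forall b, components E (frame_slots z ++ block_slots b) with
  | Ft => @curv_block 1 ITup ITlow
  | Fx => @curv_block 1 IXup IXlow
  | Fp => @curv_block (-1) IPup IPlow
  end.

Lemma curv_tensors_d_tensor z b : d_tensor (@curv_tensors z b).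
Proof. by case: z; case: b; apply: curv_comp_d_tensor. Qed.

(** The curvature has its value in the distribution of its third argument, so
    only the coordinates of that family remain in the expansion. *)
Lemma curv_equation_t g k1 k2 a : curv_field g k1 k2 (inl (inl a)) ~[dom g]
  fun g' u => \sum_d (1 * curv_coef g u k1 k2 (inl (inl a)) (inl (inl d)))
    *: delta_t N g d g' u.
Proof.
move=> g' u gu g'u; have [sW dW] := curv_field_section g k1 k2 (inl (inl a)).
have c0 k : family k <> Ft ->
    coord g u k (curv_field g k1 k2 (inl (inl a)) g u) *: adapted g k g' u = 0.
  by move=> /((family_distE Ft _ gu).1 (dW g u gu gu) k) ->; rewrite scale0r.
rewrite (adapted_decomp (fun _ x => x) sW gu g'u) /combination !big_sumType /=.
rewrite [X in _ + X + _]big1 => [|i _]; last by apply: (c0 (inl (inr i))).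
rewrite [X in _ + X]big1 => [|q _]; last by apply: (c0 (inr q)).
by rewrite !addr0; apply: eq_bigr => d _; rewrite mul1r.
Qed.

Lemma curv_equation_x g k1 k2 i : curv_field g k1 k2 (inl (inr i)) ~[dom g]
  fun g' u => \sum_l (1 * curv_coef g u k1 k2 (inl (inr i)) (inl (inr l)))
    *: delta_x N g l g' u.
Proof.
move=> g' u gu g'u; have [sW dW] := curv_field_section g k1 k2 (inl (inr i)).
have c0 k : family k <> Fx ->
    coord g u k (curv_field g k1 k2 (inl (inr i)) g u) *: adapted g k g' u = 0.
  by move=> /((family_distE Fx _ gu).1 (dW g u gu gu) k) ->; rewrite scale0r.
rewrite (adapted_decomp (fun _ x => x) sW gu g'u) /combination !big_sumType /=.
rewrite [X in X + _ + _]big1 => [|a _]; last by apply: (c0 (inl (inl a))).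
rewrite [X in _ + X]big1 => [|q _]; last by apply: (c0 (inr q)).
by rewrite addr0 add0r; apply: eq_bigr => l _; rewrite mul1r.
Qed.

Lemma curv_equation_p g k1 k2 q : curv_field g k1 k2 (inr q) ~[dom g]
  fun g' u => \sum_d \sum_l (- (-1 * curv_coef g u k1 k2 (inr q) (inr (d, l))))
    *: @d_p R m n T M E g (d, l) g' u.
Proof.
move=> g' u gu g'u; have [sW dW] := curv_field_section g k1 k2 (inr q).
have c0 k : family k <> Fp ->
    coord g u k (curv_field g k1 k2 (inr q) g u) *: adapted g k g' u = 0.
  by move=> /((family_distE Fp _ gu).1 (dW g u gu gu) k) ->; rewrite scale0r.
rewrite (adapted_decomp (fun _ x => x) sW gu g'u) /combination !big_sumType /=.
rewrite [X in X + _ + _]big1 => [|a _]; last by apply: (c0 (inl (inl a))).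
rewrite [X in _ + X + _]big1 => [|i _]; last by apply: (c0 (inl (inr i))).
rewrite !add0r pair_big; apply: eq_bigr => -[d l] _.
by rewrite mulN1r opprK.
Qed.

Lemma curv_tensors_equations : curvature_equations N D (@curv_tensors).
Proof.
move=> g.
pose t (a : 'I_m) : K := inl (inl a); pose x (i : 'I_n) : K := inl (inr i).
pose p (c : 'I_m) (k : 'I_n) : K := inr (c, k).
split; [|split; [|split; [|split; [|split]]]].
- split=> [a b c|i b c|a i b c].
  + exact: (@curv_equation_t g (t c) (t b) a).
  + exact: (@curv_equation_x g (t c) (t b) i).
  + exact: (@curv_equation_p g (t c) (t b) (a, i)).
- split=> [a b k|i b k|a i b k].
  + exact: (@curv_equation_t g (x k) (t b) a).
  + exact: (@curv_equation_x g (x k) (t b) i).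
  + exact: (@curv_equation_p g (x k) (t b) (a, i)).
- split=> [a b c k|i b c k|a i b c k].
  + exact: (@curv_equation_t g (p c k) (t b) a).
  + exact: (@curv_equation_x g (p c k) (t b) i).
  + exact: (@curv_equation_p g (p c k) (t b) (a, i)).
- split=> [a j k|i j k|a i j k].
  + exact: (@curv_equation_t g (x k) (x j) a).
  + exact: (@curv_equation_x g (x k) (x j) i).
  + exact: (@curv_equation_p g (x k) (x j) (a, i)).
- split=> [a j c k|i j c k|a i j c k].
  + exact: (@curv_equation_t g (p c k) (x j) a).
  + exact: (@curv_equation_x g (p c k) (x j) i).
  + exact: (@curv_equation_p g (p c k) (x j) (a, i)).
- split=> [a b j c k|i b j c k|a i b j c k].
  + exact: (@curv_equation_t g (p c k) (p b j) a).
  + exact: (@curv_equation_x g (p c k) (p b j) i).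
  + exact: (@curv_equation_p g (p c k) (p b j) (a, i)).
Qed.

Lemma coef_unique_t g u (W : jvfield E) (f : 'I_m -> jspace E -> R) d : dom g u ->
  W ~[dom g] (fun g' w => \sum_d f d w *: delta_t N g d g' w) ->
  f d u = coord g u (inl (inl d)) (W g u).
Proof.
move=> gu WE; rewrite WE // linear_sum (bigD1 d) //= big1 => [|d' dd'].
  rewrite addr0 -[delta_t N g d g u]/(adapted g (inl (inl d)) g u) adapted_id //.
  by rewrite /= mxE mxE !eqxx mulr1.
rewrite -[delta_t N g d' g u]/(adapted g (inl (inl d')) g u) adapted_id //.
by rewrite /= mxE mxE eq_sym (negbTE dd') andbF mulr0.
Qed.

Lemma coef_unique_x g u (W : jvfield E) (f : 'I_n -> jspace E -> R) l : dom g u ->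
  W ~[dom g] (fun g' w => \sum_l f l w *: delta_x N g l g' w) ->
  f l u = coord g u (inl (inr l)) (W g u).
Proof.
move=> gu WE; rewrite WE // linear_sum (bigD1 l) //= big1 => [|d' dd'].
  rewrite addr0 -[delta_x N g l g u]/(adapted g (inl (inr l)) g u) adapted_id //.
  by rewrite /= mxE mxE !eqxx mulr1.
rewrite -[delta_x N g d' g u]/(adapted g (inl (inr d')) g u) adapted_id //.
by rewrite /= mxE mxE eq_sym (negbTE dd') andbF mulr0.
Qed.

Lemma coef_unique_p g u (W : jvfield E) (f : 'I_m -> 'I_n -> jspace E -> R) d l :
  dom g u ->
  W ~[dom g] (fun g' w => \sum_d \sum_l f d l w *: @d_p R m n T M E g (d, l) g' w) ->
  f d l u = coord g u (inr (d, l)) (W g u).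
Proof.
move=> gu WE; rewrite WE //.
pose F (k : K) : R := if k is inr r then f r.1 r.2 u else 0.
rewrite -[LHS](coord_combination g u F (inr (d, l))).
congr (coord g u (inr (d, l)) _); rewrite !big_sumType /=.
rewrite [X in X + _ + _]big1 => [|a _]; last by rewrite scale0r.
rewrite [X in _ + X + _]big1 => [|i _]; last by rewrite scale0r.
rewrite !add0r pair_big; apply: eq_bigr => -[a i] _ /=; congr (_ *: _).
by rewrite -[RHS]/(adapted g (inr (a, i)) g u) adapted_id.
Qed.

Lemma curv_tensors_unique (C : curvature_components E) :
  curvature_equations N D C ->
  forall z b g u I, dom g u -> C z b g u I = @curv_tensors z b g u I.
Proof.
move=> eqC z b g u I gu.
have [[e1 e2 e3] [[e4 e5 e6] [[e7 e8 e9] [[e10 e11 e12] [[e13 e14 e15]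
  [e16 e17 e18]]]]]] := eqC g.
move: I; case: z; case: b => -[i0 [i1 [i2 [i3 []]]]];
  rewrite /curv_tensors /curv_block /curv_comp /= ?mul1r.
- exact: (coef_unique_t i0 gu (e1 i1 i2 i3)).
- exact: (coef_unique_t i0 gu (e4 i1 i2 i3)).
- by case: i3 => c k; exact: (coef_unique_t i0 gu (e7 i1 i2 c k)).
- exact: (coef_unique_t i0 gu (e10 i1 i2 i3)).
- by case: i3 => c k; exact: (coef_unique_t i0 gu (e13 i1 i2 c k)).
- by case: i2 i3 => b j [c k]; exact: (coef_unique_t i0 gu (e16 i1 b j c k)).
- exact: (coef_unique_x i0 gu (e2 i1 i2 i3)).
- exact: (coef_unique_x i0 gu (e5 i1 i2 i3)).
- by case: i3 => c k; exact: (coef_unique_x i0 gu (e8 i1 i2 c k)).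
- exact: (coef_unique_x i0 gu (e11 i1 i2 i3)).
- by case: i3 => c k; exact: (coef_unique_x i0 gu (e14 i1 i2 c k)).
- by case: i2 i3 => b j [c k]; exact: (coef_unique_x i0 gu (e17 i1 b j c k)).
- case: i0 i1 => d l [a i]; rewrite mulN1r; apply: oppr_inj; rewrite opprK.
  exact: (coef_unique_p d l gu (e3 a i i2 i3)).
- case: i0 i1 => d l [a i]; rewrite mulN1r; apply: oppr_inj; rewrite opprK.
  exact: (coef_unique_p d l gu (e6 a i i2 i3)).
- case: i0 i1 i3 => d l [a i] [c k]; rewrite mulN1r; apply: oppr_inj; rewrite opprK.
  exact: (coef_unique_p d l gu (e9 a i i2 c k)).
- case: i0 i1 => d l [a i]; rewrite mulN1r; apply: oppr_inj; rewrite opprK.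
  exact: (coef_unique_p d l gu (e12 a i i2 i3)).
- case: i0 i1 i3 => d l [a i] [c k]; rewrite mulN1r; apply: oppr_inj; rewrite opprK.
  exact: (coef_unique_p d l gu (e15 a i i2 c k)).
case: i0 i1 i2 i3 => d l [a i] [b j] [c k]; rewrite mulN1r.
apply: oppr_inj; rewrite opprK.
exact: (coef_unique_p d l gu (e18 a i b j c k)).
Qed.

Lemma curv_coef_other g u k1 k2 k3 k0 : dom g u -> family k0 <> family k3 ->
  curv_coef g u k1 k2 k3 k0 = 0.
Proof.
move=> gu k03; have [_ dW] := curv_field_section g k1 k2 k3.
exact: (family_distE _ _ gu).1 (dW g u gu gu) k0 k03.
Qed.

Lemma curv_coef_antisym g u k1 k2 k3 k0 : dom g u ->
  curv_coef g u k2 k1 k3 k0 = - curv_coef g u k1 k2 k3 k0.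
Proof.
move=> gu; have s k := smooth_adapted g k.
rewrite /curv_coef /curv_field.
have A := curvature_antisym bV sT connD (cdom_open (ch g)) (s k1) (s k2) (s k3) gu gu.
apply: (etrans (congr1 (coord g u k0) A)).
exact: (linearN (coord g u k0)).
Qed.

End Curvature.

(** A coefficient which is not among the components of the 18 tensors either
    vanishes, when its upper index is in another family than its third
    argument, or is the opposite of one that is, by antisymmetry in the first
    two arguments. *)
Lemma curv_coef_determined D D' g u : N_linear_connection N D ->
  N_linear_connection N D' -> dom g u ->
  (forall z b I, @curv_tensors D z b g u I = @curv_tensors D' z b g u I) ->
  forall k1 k2 k3 k0, curv_coef D g u k1 k2 k3 k0 = curv_coef D' g u k1 k2 k3 k0.
Proof.
move=> hD hD' gu H.
have n1 : (1 : R) != 0 := oner_neq0 R.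
have nN1 : (-1 : R) != 0 by rewrite oppr_eq0.
have same k1 k2 k3 k0 : (match family k2, family k1 with
    | Ft, _ | Fx, Fx | Fx, Fp | Fp, Fp => true | _, _ => false end) ->
    family k0 = family k3 ->
    curv_coef D g u k1 k2 k3 k0 = curv_coef D' g u k1 k2 k3 k0.
  move: k1 k2 k3 k0 => [[c|k]|[c k]] [[b|j]|[b j]] [[a|i]|[a i]] [[d|l]|[d l]] //= _ _.
  - exact: (mulfI n1 (H Ft Btt (d, (a, (b, (c, tt)))))).
  - exact: (mulfI n1 (H Fx Btt (l, (i, (b, (c, tt)))))).
  - exact: (mulfI nN1 (H Fp Btt ((d, l), ((a, i), (b, (c, tt)))))).
  - exact: (mulfI n1 (H Ft Btx (d, (a, (b, (k, tt)))))).
  - exact: (mulfI n1 (H Fx Btx (l, (i, (b, (k, tt)))))).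
  - exact: (mulfI nN1 (H Fp Btx ((d, l), ((a, i), (b, (k, tt)))))).
  - exact: (mulfI n1 (H Ft Bxx (d, (a, (j, (k, tt)))))).
  - exact: (mulfI n1 (H Fx Bxx (l, (i, (j, (k, tt)))))).
  - exact: (mulfI nN1 (H Fp Bxx ((d, l), ((a, i), (j, (k, tt)))))).
  - exact: (mulfI n1 (H Ft Btp (d, (a, (b, ((c, k), tt)))))).
  - exact: (mulfI n1 (H Fx Btp (l, (i, (b, ((c, k), tt)))))).
  - exact: (mulfI nN1 (H Fp Btp ((d, l), ((a, i), (b, ((c, k), tt)))))).
  - exact: (mulfI n1 (H Ft Bxp (d, (a, (j, ((c, k), tt)))))).
  - exact: (mulfI n1 (H Fx Bxp (l, (i, (j, ((c, k), tt)))))).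
  - exact: (mulfI nN1 (H Fp Bxp ((d, l), ((a, i), (j, ((c, k), tt)))))).
  - exact: (mulfI n1 (H Ft Bpp (d, (a, ((b, j), ((c, k), tt)))))).
  - exact: (mulfI n1 (H Fx Bpp (l, (i, ((b, j), ((c, k), tt)))))).
  - exact: (mulfI nN1 (H Fp Bpp ((d, l), ((a, i), ((b, j), ((c, k), tt)))))).
move=> k1 k2 k3 k0.
have [k03|k03] : family k0 = family k3 \/ family k0 <> family k3.
  by case: (family k0) (family k3) => [] []; by [left|right].
  case: (boolP (match family k2, family k1 with
    | Ft, _ | Fx, Fx | Fx, Fp | Fp, Fp => true | _, _ => false end)) => k12.
    exact: same.
  rewrite (curv_coef_antisym hD k2 k1 k3 k0 gu) (curv_coef_antisym hD' k2 k1 k3 k0 gu).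
  by rewrite same //; case: (family k2) (family k1) k12 => [] [].
by rewrite (curv_coef_other hD) // (curv_coef_other hD').
Qed.

Lemma curvature_determined D D' : N_linear_connection N D ->
  N_linear_connection N D' ->
  (forall z b g u I, dom g u ->
     @curv_tensors D z b g u I = @curv_tensors D' z b g u I) ->
  forall U X Y Z, open U -> SV U X -> SV U Y -> SV U Z ->
    curvature ch D' X Y Z ~[U] curvature ch D X Y Z.
Proof.
move=> hD hD' H U0 X Y Z oU0 sX0 sY0 sZ0 g u U0u gu; set U := U0 `&` dom g.
have oU : open U by apply: openI => //; exact: cdom_open.
have Ug : U `<=` dom g by exact: subIsetr.
have restr A : SV U0 A -> SV U A by apply: smooth_vfield_sub; exact: subIsetl.
have [sX sY sZ] := And3 (restr _ sX0) (restr _ sY0) (restr _ sZ0).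
have sa k : SV U (adapted g k) := smooth_vfield_sub Ug (smooth_adapted g k).
have dec A (sA : SV U A) := adapted_decomp Ug sA.
have sc A (sA : SV U A) k := smooth_coord_vfield k oU Ug sA.
have ex D0 (hD0 : linear_connection ch D0) := curvature_expand bV sT hD0 oU Ug sa
  (sc _ sX) (sc _ sY) (sc _ sZ) sX sY sZ (dec _ sX) (dec _ sY) (dec _ sZ)
  (conj U0u gu) gu.
have [lD lD'] : linear_connection ch D /\ linear_connection ch D'.
  by case: hD; case: hD'.
apply: (etrans (ex D' lD')); apply: (etrans _ (esym (ex D lD))).
do 3![apply: eq_bigr => ? _]; do 3!congr (_ *: _).
apply: (etrans (coord_decomp g u _)); apply: (etrans _ (esym (coord_decomp g u _))).
apply: eq_bigr => k _; congr (_ *: _); apply: esym.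
by apply: (curv_coef_determined hD hD' gu) => z b I; exact: H.
Qed.

End AdaptedFrame.

Theorem theorem8p2 (R : realType) (m n : nat)
    (T : manifold R m) (M : manifold R n) (E : dual_jet_bundle T M)
    (N : nonlinear_connection E)
    (D : jvfield E -> jvfield E -> jvfield E)
    (hD : N_linear_connection N D) :
  exists C : curvature_components E,
    curvature_equations N D C /\
    (forall (z : frame) (b : block), d_tensor (C z b)) /\
    (forall C' : curvature_components E, curvature_equations N D C' ->
       forall (z : frame) (b : block) g u I,
         cdom (jchart E g) u -> C' z b g u I = C z b g u I) /\
    (forall D' : jvfield E -> jvfield E -> jvfield E,
       N_linear_connection N D' -> curvature_equations N D' C ->
       forall (U : set (jspace E)) (X Y Z : jvfield E), open U ->
         smooth_vfield (@jchart R m n T M E) U X ->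
         smooth_vfield (@jchart R m n T M E) U Y ->
         smooth_vfield (@jchart R m n T M E) U Z ->
         vfield_eq (@jchart R m n T M E) U
           (curvature (@jchart R m n T M E) D' X Y Z)
           (curvature (@jchart R m n T M E) D X Y Z)).
Proof.
exists (@curv_tensors R m n T M E N D).
split; first exact: curv_tensors_equations.
split=> [z b|]; first exact: curv_tensors_d_tensor.
split=> [C' eqC' z b g u I gu|]; first exact: (curv_tensors_unique eqC').
move=> D' hD' eqD' U X Y Z; apply: (curvature_determined hD hD').
by move=> z b g u I gu; exact: (curv_tensors_unique eqD').
Qed.
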